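(* Let $G$ be a reductive algebraic group over an algebraically closed field $k$ of characteristic $0$, let $H$ be a closed subgroup of $G$, and let $M$ and $N$ be finite dimensional $G$-modules. Then $$\mathrm{Ext}^i_{(G,H)}(M,N)=0\quad\text{for all } i>0.$$
   Context: Modules are rational modules. An exact sequence of $G$-modules with differentials $d_i:M_i\to M_{i+1}$ is $(G,H)$-exact if $\mathrm{Ker}(d_i)$ is a direct $H$-module summand of $M_i$ for all $i$. A $G$-module $I$ is $(G,H)$-injective if for every $(G,H)$-exact sequence $0\to M_1\xrightarrow{d_1}M_2\to M_3\to0$ and every $G$-homomorphism $f:M_1\to I$ there is a $G$-homomorphism $h:M_2\to I$ with $f=h\circ d_1$. A $(G,H)$-injective resolution of $N$ is a $(G,H)$-exact sequence $0\to N\to I_0\to I_1\to\cdots$ with all $I_j$ being $(G,H)$-injective; these exist. $\mathrm{Ext}^i_{(G,H)}(M,N)$ is the $i$-th cohomology of $0\to\mathrm{Hom}_G(M,I_0)\to\mathrm{Hom}_G(M,I_1)\to\cdots$ (independent of the resolution). *)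

(* Defs.v *)
From HB Require Import structures.
From mathcomp Require Import all_boot all_order all_algebra.
From mathcomp Require Import all_classical.

Set Implicit Arguments.
Unset Strict Implicit.
Unset Printing Implicit Defensive.

Import GRing.Theory.

Local Open Scope classical_set_scope.
Local Open Scope ring_scope.

(* Affine varieties over the algebraically closed field k are represented by
   their set of k-points together with their coordinate ring, seen as a
   k-algebra of functions on the points. *)
Section CoordinateRing.
Variables (k : closedFieldType) (X : Type).
Implicit Types (A : set (X -> k)) (phi : (X -> k) -> k).

Definition subalgebra A : Prop :=
  [/\ forall c : k, A (fun=> c),
      forall f g, A f -> A g -> A (fun x => f x + g x)
    & forall f g, A f -> A g -> A (fun x => f x * g x)].

Definition finitely_generated A : Prop :=
  exists n (s : 'I_n -> X -> k),
    (forall i, A (s i)) /\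
    forall B, subalgebra B -> (forall i, B (s i)) -> A `<=` B.

(* Only the values of phi on A matter. *)
Definition algebra_hom A phi : Prop :=
  [/\ forall c : k, phi (fun=> c) = c,
      forall f g, A f -> A g -> phi (fun x => f x + g x) = phi f + phi g
    & forall f g, A f -> A g -> phi (fun x => f x * g x) = phi f * phi g].

End CoordinateRing.

(* The fields reg_separates and reg_points say that evaluation is a bijection
   from the points onto the k-algebra homomorphisms k[G] -> k; reg_mul and
   reg_inv say that multiplication and inversion are morphisms of varieties. *)
Record algGroup (k : closedFieldType) := AlgGroup {
  points :> groupType;
  reg : set (points -> k);
  reg_subalgebra : subalgebra reg;
  reg_fingen : finitely_generated reg;
  reg_separates : forall x y : points,
    (forall f, reg f -> f x = f y) -> x = y;
  reg_points : forall phi : (points -> k) -> k, algebra_hom reg phi ->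
    exists x : points, forall f, reg f -> phi f = f x;
  reg_mul : forall f, reg f -> exists n (a b : 'I_n -> points -> k),
    (forall i, reg (a i) /\ reg (b i)) /\
    forall x y : points, f (x * y)%g = \sum_(i < n) a i x * b i y;
  reg_inv : forall f, reg f -> reg (fun x : points => f (x^-1)%g)
}.

Section Subgroups.
Variables (k : closedFieldType) (G : algGroup k).
Implicit Types (A U : set G).

Definition zclosed A : Prop :=
  exists2 S : set (G -> k), S `<=` reg (a := G)
    & A = [set x | forall f, S f -> f x = 0].

Definition zconnected A : Prop :=
  forall B C : set G, zclosed B -> zclosed C ->
    A `<=` B `|` C -> A `&` B `&` C = set0 ->
    A `&` B = set0 \/ A `&` C = set0.

Definition subgroup A : Prop :=
  [/\ A 1%g, forall x y, A x -> A y -> A (x * y)%g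
    & forall x, A x -> A (x^-1)%g].

Definition closed_subgroup A : Prop := subgroup A /\ zclosed A.

Definition normal_subset A : Prop :=
  forall g x : G, A x -> A (g * x * g^-1)%g.

(* u is unipotent when right translation by u is a locally unipotent operator
   on k[G]. *)
Definition unipotent_elt (u : G) : Prop :=
  forall f, reg f -> exists n,
    forall x : G, iter n (fun (h : G -> k) y => h (y * u)%g - h y) f x = 0.

Definition unipotent U : Prop := forall u, U u -> unipotent_elt u.

(* The closed connected normal unipotent subgroups of G have a largest
   element, which is therefore their union. *)
Definition unipotent_radical : set G :=
  [set x | exists2 U : set G,
     [/\ closed_subgroup U, zconnected U, normal_subset U & unipotent U]
     & U x].

(* G itself is not required to be connected. *)
Definition reductive : Prop := unipotent_radical = [set 1%g].

End Subgroups.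

(* Rational modules, possibly of infinite dimension: the orbit map of each
   vector v has the form g |-> \sum_i a_i(g) w_i with a_i in k[G]. *)
Record ratModule (k : closedFieldType) (G : algGroup k) := RatModule {
  carrier :> lmodType k;
  act : G -> carrier -> carrier;
  act_linear : forall g, linear (act g);
  act1 : forall v, act 1%g v = v;
  actM : forall (g h : G) v, act (g * h)%g v = act g (act h v);
  act_rational : forall v, exists n (a : 'I_n -> G -> k) (w : 'I_n -> carrier),
    (forall i, reg (a i)) /\ forall g, act g v = \sum_(i < n) a i g *: w i
}.

Definition finite_dimensional (k : closedFieldType) (V : lmodType k) : Prop :=
  exists n (e : 'I_n -> V),
    forall v, exists c : 'I_n -> k, v = \sum_(i < n) c i *: e i.

Section HomG.
Variables (k : closedFieldType) (G : algGroup k) (M N : ratModule G).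

Definition is_ghom : {pred M -> N} :=
  fun f => `[< linear f /\ forall g m, f (act g m) = act g (f m) >].

Fact is_ghom_zmod_closed : zmod_closed is_ghom.
Proof.
have actB g : zmod_morphism (act (r := N) g).
  exact: GRing.zmod_morphism_linear (act_linear g).
have act0 g : act (r := N) g 0 = 0 by rewrite -[X in act _ X](subrr 0) actB subrr.
split=> [|f h]; last move=> /asboolP[fl fG] /asboolP[hl hG].
all: rewrite unfold_in; apply/asboolP; split.
- by move=> a u v; rewrite /= scaler0 addr0.
- by move=> g m; rewrite /= act0.
- move=> a u v; rewrite !fctE fl hl scalerBr opprD !addrA.
  by congr (_ - _); rewrite -!addrA; congr (_ + _); rewrite addrC.
- by move=> g m; rewrite !fctE fG hG actB.
Qed.

HB.instance Definition _ := GRing.isZmodClosed.Build _ is_ghom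
  is_ghom_zmod_closed.

Record HomG := MkHomG { hom_fun :> M -> N; _ : hom_fun \in is_ghom }.

Fact HomGP (f : HomG) : linear f /\ forall g m, f (act g m) = act g (f m).
Proof. by apply/asboolP; case: f. Qed.

HB.instance Definition _ := [isSub for hom_fun].
HB.instance Definition _ := [Choice of HomG by <:].
HB.instance Definition _ := [SubChoice_isSubZmodule of HomG by <:].

End HomG.

Arguments is_ghom {k G} M N.

Section Comp.
Variables (k : closedFieldType) (G : algGroup k) (M N P : ratModule G).

Fact comp_is_ghom (h : HomG N P) (f : HomG M N) : h \o f \in is_ghom M P.
Proof.
have [[hl hG] [fl fG]] := (HomGP h, HomGP f).
rewrite unfold_in; apply/asboolP.
by split=> [a u v|g m] /=; rewrite ?fl ?hl ?fG ?hG.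
Qed.

Definition compG (h : HomG N P) (f : HomG M N) : HomG M P :=
  MkHomG (comp_is_ghom h f).

Fact compG_is_zmod_morphism (h : HomG N P) : zmod_morphism (compG h).
Proof.
move=> f g; apply: val_inj; apply/funext => m /=.
exact: (GRing.zmod_morphism_linear (HomGP h).1).
Qed.

HB.instance Definition _ (h : HomG N P) :=
  GRing.isZmodMorphism.Build (HomG M N) (HomG M P) (compG h)
    (compG_is_zmod_morphism h).

End Comp.

Section RelativeExactness.
Variables (k : closedFieldType) (G : algGroup k) (H : set G).
Implicit Types (M N : ratModule G).

Definition Ker M N (f : HomG M N) : set M := [set m | f m = 0].
Definition Im M N (f : HomG M N) : set N := range f.

Definition Hsubmodule M (W : set M) : Prop :=
  [/\ W 0, forall (a : k) u v, W u -> W v -> W (a *: u + v)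
    & forall h u, H h -> W u -> W (act h u)].

Definition Hsummand M (W : set M) : Prop :=
  Hsubmodule W /\
  exists W' : set M, [/\ Hsubmodule W', W `&` W' = [set 0]
    & forall m, exists u v, [/\ W u, W' v & m = u + v]].

(* Exactness at M of a sequence _ -> M -> _ whose incoming map has image A and
   whose outgoing map has kernel K, together with the splitting condition. The
   image of 0 -> M is [set 0] and the kernel of M -> 0 is setT. *)
Definition GHexact_at M (A K : set M) : Prop := A = K /\ Hsummand K.

Definition GHshort_exact (M1 M2 M3 : ratModule G)
    (d1 : HomG M1 M2) (d2 : HomG M2 M3) : Prop :=
  [/\ GHexact_at [set 0] (Ker d1), GHexact_at (Im d1) (Ker d2)
    & GHexact_at (Im d2) [set: M3]].

Definition GHinjective (I : ratModule G) : Prop :=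
  forall (M1 M2 M3 : ratModule G) (d1 : HomG M1 M2) (d2 : HomG M2 M3),
    GHshort_exact d1 d2 ->
    forall f : HomG M1 I, exists h : HomG M2 I, f = compG h d1.

Record GHresolution (N : ratModule G) := MkGHresolution {
  res_mod :> nat -> ratModule G;
  res_aug : HomG N (res_mod 0%N);
  res_diff : forall i, HomG (res_mod i) (res_mod i.+1);
  res_exactN : GHexact_at [set 0] (Ker res_aug);
  res_exact0 : GHexact_at (Im res_aug) (Ker (res_diff 0%N));
  res_exactS : forall i,
    GHexact_at (Im (res_diff i)) (Ker (res_diff i.+1));
  res_injective : forall i, GHinjective (res_mod i)
}.

End RelativeExactness.

Section Cohomology.
Variables (C : nat -> zmodType) (d : forall i, {additive C i -> C i.+1}).

Definition is_cocycle i : {pred C i} := fun x => d i x == 0.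

Fact is_cocycle_zmod_closed i : zmod_closed (@is_cocycle i).
Proof.
split=> [|x y]; rewrite !unfold_in ?raddf0 //.
by move=> /eqP dx /eqP dy; rewrite raddfB dx dy subrr.
Qed.

HB.instance Definition _ i := GRing.isZmodClosed.Build _ (@is_cocycle i)
  (is_cocycle_zmod_closed i).

Record cocycle i := MkCocycle
  { cocycle_val :> C i; _ : cocycle_val \in @is_cocycle i }.

HB.instance Definition _ i := [isSub for @cocycle_val i].
HB.instance Definition _ i := [Choice of cocycle i by <:].
HB.instance Definition _ i := [SubChoice_isSubZmodule of cocycle i by <:].

(* The incoming differential in degree 0 is 0 -> C 0. *)
Definition is_coboundary i : {pred cocycle i} :=
  match i with
  | 0%N => fun z => z == 0
  | j.+1 => fun z => `[< exists y : C j, d j y = val z >]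
  end.

Fact is_coboundary_zmod_closed i : zmod_closed (@is_coboundary i).
Proof.
case: i => [|i]; split=> [|x y]; rewrite !unfold_in /=.
- by [].
- by move=> /eqP-> /eqP->; rewrite subrr.
- by apply/asboolP; exists 0; rewrite !raddf0.
- move=> /asboolP[u du] /asboolP[v dv]; apply/asboolP.
  by exists (u - v); rewrite !raddfB du dv.
Qed.

HB.instance Definition _ i := GRing.isZmodClosed.Build _ (@is_coboundary i)
  (is_coboundary_zmod_closed i).

Definition cohomology i : zmodType :=
  Quotient.quot (@is_coboundary i : zmodClosed (cocycle i)).

End Cohomology.

(* Ext^i_(G,H)(M, N) computed from the (G,H)-injective resolution I of N. *)
Definition Ext (k : closedFieldType) (G : algGroup k) (H : set G)
    (M N : ratModule G) (I : GHresolution H N) (i : nat) : zmodType :=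
  @cohomology (fun j => HomG M (I j))
    (fun j => @compG k G M (I j) (I j.+1) (res_diff I j)) i.

(* Main.v *)
(* Once every surjective G-map is surjective on G-maps out of M, the complex of
   Hom_G(M, I_j) is exact in positive degrees, whatever H is. Averaging a linear lift
   reduces this to the linear reductivity of G: an invariant column vector c <> 0 of a
   rational representation E is paired to 1 by some invariant row vector.

   If the Lie algebra g of G (the point derivations of k[G] at 1) acts by zero on E, the
   Euler operator shows that the matrix entries of E minus those of the identity lie in
   all powers of the maximal ideal of 1; by Krull's theorem E is trivial on a nonempty
   open set, so its image is finite and one averages over it. Otherwise the trace form
   on the image of g in gl(E) is nondegenerate, and the associated Casimir operator
   commutes with G, kills c and has nonzero trace; for a nonzero eigenvalue l, the
   quotient of E by the kernel of C - l is smaller than E and c survives in it.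

   Nondegeneracy rests on the unipotent radical being trivial: an ideal of g made of
   nilpotent matrices in a faithful representation V exponentiates to elements u with
   tr(u h) = tr(h) for all h, and these form a connected normal unipotent subgroup.
   Nilpotency comes from Cartan's criterion, in which the replicas of a point derivation
   replace the Jordan decomposition. *)
From HB Require Import structures.
Require Import Defs.
From mathcomp Require Import all_boot all_order all_algebra.
From mathcomp Require Import all_classical.
From mathcomp Require Import ring zify.

Set Implicit Arguments.
Unset Strict Implicit.
Unset Printing Implicit Defensive.

Import GRing.Theory.

Local Open Scope ring_scope.

(** * The coordinate ring, point derivations and matrix representations *)

Section RegularFunctions.
Variables (k : closedFieldType) (G : algGroup k).

(** Two devices reduce everything to matrices. Any finite family of regular functions containing 1
    consists of coefficients of one representation with a common row vector ([matrix_coefs]), so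
    derivations, translations and averages become matrix computations. Faithfulness of V means that
    its entries generate k[G], so a property of all regular functions is checked on entries, sums
    and products.

    E alone cannot carry the argument: a derivation may act on E by a nilpotent or zero matrix
    without vanishing, whereas vanishing on V forces it to be 0. A replica is a functional on k[G],
    hence the same object in E and in V, and this allows nilpotency to be carried from one to the
    other. Since k is an arbitrary field of characteristic 0, positivity enters through additive
    maps from k to the rationals.

    As G may be disconnected, triviality of E on an open set around 1 gives only a finite image:
    finitely many translates of that set cover G. Finally, an invariant row for the column of values
    of the constant 1 supplies weights and points that replace an invariant integral on finitely
    many functions. *)

Definition is_reg : {pred G -> k} := fun f => `[< reg f >].

Lemma is_regP (f : G -> k) : reflect (reg f) (f \in is_reg).
Proof. exact: asboolP. Qed.

Fact is_reg_subring : subring_closed is_reg.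
Proof.
have [Ac Ad Am] := @reg_subalgebra k G.
have AM f g : f \in is_reg -> g \in is_reg -> f * g \in is_reg.
  by move=> /is_regP Af /is_regP Ag; apply/is_regP/Am.
split=> //; first exact/is_regP/Ac.
move=> f g /is_regP Af /is_regP Ag; apply/is_regP.
suff -> : f - g = (fun x => f x + (fun y => (fun=> -1) y * g y) x).
  by apply: Ad => //; apply: Am.
by apply/funext => x; rewrite !fctE mulN1r.
Qed.

HB.instance Definition _ := GRing.isSubringClosed.Build _ is_reg is_reg_subring.

Record regf := RegF { regf_fun :> G -> k; _ : regf_fun \in is_reg }.

HB.instance Definition _ := [isSub for regf_fun].
HB.instance Definition _ := [Choice of regf by <:].
HB.instance Definition _ := GRing.SubChoice_isSubComPzRing.Build _ _ regf is_reg_subring.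

Lemma regfP (f : regf) : reg f.
Proof. by apply/is_regP; case: f. Qed.

Lemma regf_ext (f g : regf) : (forall x, f x = g x) -> f = g.
Proof. by move=> fg; apply: val_inj; apply/funext. Qed.

Fact regf_nonzero : (1 : regf) != 0.
Proof.
by apply/eqP => /(congr1 (fun f : regf => f 1%g)) /eqP; rewrite oner_eq0.
Qed.

HB.instance Definition _ := GRing.PzSemiRing_isNonZero.Build regf regf_nonzero.

Definition mkregf (f : G -> k) (Af : reg f) : regf := RegF (introT (is_regP f) Af).

Definition regf_scale (c : k) (f : regf) : regf :=
  mkregf (let: And3 Ac _ Am := @reg_subalgebra k G in
          Am _ _ (Ac c) (regfP f)).

Fact regf_scaleA a b f : regf_scale a (regf_scale b f) = regf_scale (a * b) f.
Proof. by apply: regf_ext => x; rewrite /= mulrA. Qed.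
Fact regf_scale1 : left_id 1 regf_scale.
Proof. by move=> f; apply: regf_ext => x; rewrite /= mul1r. Qed.
Fact regf_scaleDr : right_distributive regf_scale +%R.
Proof. by move=> c f g; apply: regf_ext => x; rewrite /= !fctE mulrDr. Qed.
Fact regf_scaleDl f : {morph regf_scale^~ f : a b / a + b}.
Proof. by move=> a b; apply: regf_ext => x; rewrite /= !fctE mulrDl. Qed.

HB.instance Definition _ := GRing.Zmodule_isLmodule.Build k regf
  regf_scaleA regf_scale1 regf_scaleDr regf_scaleDl.

Fact regf_scaleAl a (f g : regf) : a *: (f * g) = (a *: f) * g.
Proof. by apply: regf_ext => x; rewrite /= !fctE mulrA. Qed.

HB.instance Definition _ := GRing.Lmodule_isLalgebra.Build k regf regf_scaleAl.

Definition ev (x : G) (f : regf) : k := f x.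

Fact ev_zmod x : zmod_morphism (ev x). Proof. by []. Qed.
Fact ev_monoid x : monoid_morphism (ev x). Proof. by []. Qed.
HB.instance Definition _ x := GRing.isZmodMorphism.Build _ _ (ev x) (ev_zmod x).
HB.instance Definition _ x := GRing.isMonoidMorphism.Build _ _ (ev x) (ev_monoid x).

Lemma regfD (f g : regf) x : (f + g) x = f x + g x. Proof. by []. Qed.
Lemma regfN (f : regf) x : (- f) x = - f x. Proof. by []. Qed.
Lemma regfB (f g : regf) x : (f - g) x = f x - g x. Proof. by []. Qed.
Lemma regfM (f g : regf) x : (f * g) x = f x * g x. Proof. by []. Qed.
Lemma regfZ c (f : regf) x : (c *: f) x = c * f x. Proof. by []. Qed.
Lemma regf1 x : (1 : regf) x = 1. Proof. by []. Qed.
Lemma regf0 x : (0 : regf) x = 0. Proof. by []. Qed.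
Lemma regf_sum I (r : seq I) (P : pred I) (F : I -> regf) x :
  (\sum_(i <- r | P i) F i) x = \sum_(i <- r | P i) F i x.
Proof. exact: (raddf_sum (ev x)). Qed.
Definition regfE :=
  (regfD, regfN, regfM, regfZ, regf1, regf0, regf_sum).

Lemma regf_mulP (f : regf) : exists n (a b : 'I_n -> regf),
  forall x y, f (x * y)%g = \sum_(i < n) a i x * b i y.
Proof.
have [n [a [b [Aab fab]]]] := reg_mul (regfP f).
by exists n, (fun i => mkregf (Aab i).1), (fun i => mkregf (Aab i).2).
Qed.

Lemma reg_sumr n (a : 'I_n -> k) (b : 'I_n -> regf) :
  reg (fun x => \sum_i a i * b i x).
Proof.
suff -> : (fun x => \sum_i a i * b i x) = \sum_i a i *: b i by exact: regfP.
by apply/funext => x; rewrite regfE.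
Qed.

Fact ltr_reg (g : G) (f : regf) : reg (fun x => f (g * x)%g).
Proof.
have [n [a [b fab]]] := regf_mulP f.
rewrite (_ : (fun x => _) = fun x => \sum_i a i g * b i x); first exact: reg_sumr.
by apply/funext => x; rewrite fab.
Qed.

Definition ltr g f : regf := mkregf (ltr_reg g f).
Definition invf (f : regf) : regf := mkregf (reg_inv (regfP f)).

Fact ltr_zmod g : zmod_morphism (ltr g).
Proof. by move=> f h; apply: regf_ext. Qed.
HB.instance Definition _ g := GRing.isZmodMorphism.Build _ _ (ltr g) (ltr_zmod g).
Lemma ltrZ g c f : ltr g (c *: f) = c *: ltr g f.
Proof. exact: regf_ext. Qed.
Lemma ltr_mul g f h : ltr g (f * h) = ltr g f * ltr g h.
Proof. exact: regf_ext. Qed.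

Fact rtr_reg (g : G) (f : regf) : reg (fun x => f (x * g)%g).
Proof.
have [n [a [b fab]]] := regf_mulP f.
rewrite (_ : (fun x => _) = fun x => \sum_i b i g * a i x); first exact: reg_sumr.
by apply/funext => x; rewrite fab; apply: eq_bigr => i _; rewrite mulrC.
Qed.

Definition rtr g f : regf := mkregf (rtr_reg g f).

(* A tangent vector of G at the identity. *)
Definition pder (d : regf -> k) : Prop :=
  (forall c f g, d (c *: f + g) = c * d f + d g) /\
  forall f g, d (f * g) = f 1%g * d g + d f * g 1%g.

Section PointDerivation.
Variables (d : regf -> k) (dP : pder d).

Lemma pder0 : d 0 = 0.
Proof.
have := dP.1 1 0 0; rewrite scale1r mul1r addr0 => e.
by apply: (addrI (d 0)); rewrite -e addr0.
Qed.
Lemma pderD f g : d (f + g) = d f + d g.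
Proof. by have := dP.1 1 f g; rewrite scale1r mul1r. Qed.
Lemma pderZ c f : d (c *: f) = c * d f.
Proof. by have := dP.1 c f 0; rewrite pder0 !addr0. Qed.
Lemma pderN f : d (- f) = - d f.
Proof. by rewrite -scaleN1r pderZ mulN1r. Qed.
Lemma pderB f g : d (f - g) = d f - d g.
Proof. by rewrite pderD pderN. Qed.
Lemma pder_sum I (r : seq I) (P : pred I) (F : I -> regf) :
  d (\sum_(i <- r | P i) F i) = \sum_(i <- r | P i) d (F i).
Proof. by apply: (big_morph d pderD pder0). Qed.
Lemma pder1 : d 1 = 0.
Proof.
have := dP.2 1 1; rewrite mulr1 !regf1 mul1r mulr1 => e.
by apply: (addrI (d 1)); rewrite -e addr0.
Qed.

Fact linv_reg (f : regf) : reg (fun x => d (ltr x f)).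
Proof.
have [n [a [b fab]]] := regf_mulP f.
rewrite (_ : (fun x => _) = fun x => \sum_i d (b i) * a i x); first exact: reg_sumr.
apply/funext => x.
have -> : ltr x f = \sum_i a i x *: b i.
  by apply: regf_ext => y; rewrite regf_sum /= fab.
by rewrite pder_sum; apply: eq_bigr => i _; rewrite pderZ mulrC.
Qed.

(* The left-invariant derivation of k[G] whose value at the identity is d. *)
Definition linv f : regf := mkregf (linv_reg f).

Lemma linvE f x : linv f x = d (ltr x f). Proof. by []. Qed.

Lemma linv1 f : linv f 1%g = d f.
Proof. by rewrite linvE; congr d; apply: regf_ext => x /=; rewrite mul1g. Qed.

Fact linv_zmod : zmod_morphism linv.
Proof. by move=> f g; apply: regf_ext => x; rewrite linvE raddfB pderB. Qed.
HB.instance Definition _ := GRing.isZmodMorphism.Build _ _ linv linv_zmod.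

Lemma linvZ c f : linv (c *: f) = c *: linv f.
Proof. by apply: regf_ext => x; rewrite linvE ltrZ pderZ. Qed.

Lemma linvM f g : linv (f * g) = linv f * g + f * linv g.
Proof.
apply: regf_ext => x; rewrite regfD !regfM !linvE ltr_mul dP.2 /= !mulg1.
by rewrite addrC.
Qed.

Lemma linv_const c : linv (c *: 1) = 0.
Proof.
apply: regf_ext => x; rewrite linvE.
have -> : ltr x (c *: 1) = c *: 1 by apply: regf_ext.
by rewrite pderZ pder1 mulr0.
Qed.

End PointDerivation.

(* A rational representation on column vectors, as a matrix of functions. *)
Record mrep n := MRep {
  rmat : 'M[regf]_n;
  rmat1 : map_mx (ev 1%g) rmat = 1%:M;
  rmatM : forall x y, map_mx (ev (x * y)%g) rmat =
                      map_mx (ev x) rmat *m map_mx (ev y) rmat }.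

Definition rho n (r : mrep n) (x : G) : 'M[k]_n := map_mx (ev x) (rmat r).
Definition dmx n (d : regf -> k) (r : mrep n) : 'M[k]_n := map_mx d (rmat r).

Lemma rho1 n (r : mrep n) : rho r 1%g = 1%:M. Proof. exact: rmat1. Qed.
Lemma rhoM n (r : mrep n) x y : rho r (x * y)%g = rho r x *m rho r y.
Proof. exact: rmatM. Qed.
Lemma rhoVr n (r : mrep n) x : rho r x *m rho r x^-1%g = 1%:M.
Proof. by rewrite -rhoM mulgV rho1. Qed.
Lemma rhoVl n (r : mrep n) x : rho r x^-1%g *m rho r x = 1%:M.
Proof. by rewrite -rhoM mulVg rho1. Qed.
Lemma rhoE n (r : mrep n) x i j : rho r x i j = rmat r i j x.
Proof. by rewrite mxE. Qed.
Lemma rhoX n (r : mrep n.+1) x m : rho r (x ^+ m)%g = rho r x ^+ m.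
Proof.
by elim: m => [|m IH]; rewrite ?expg0 ?rho1 // expgS rhoM IH exprS.
Qed.

Lemma mkrep n (M : G -> 'M[k]_n) : (forall i j, reg (fun x => M x i j)) ->
  M 1%g = 1%:M -> (forall x y, M (x * y)%g = M x *m M y) ->
  exists r : mrep n, forall x, rho r x = M x.
Proof.
move=> Mreg M1 MM.
pose R : 'M[regf]_n := \matrix_(i, j) mkregf (Mreg i j).
have RE x : map_mx (ev x) R = M x by apply/matrixP => i j; rewrite !mxE.
have R1 : map_mx (ev 1%g) R = 1%:M by rewrite RE.
have RM x y : map_mx (ev (x * y)%g) R = map_mx (ev x) R *m map_mx (ev y) R.
  by rewrite !RE.
by exists (MRep R1 RM).
Qed.

Definition mcoef n (r : mrep n) (u : 'rV[k]_n) (v : 'cV[k]_n) : regf :=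
  \sum_i \sum_j (u 0 i * v j 0) *: rmat r i j.

Lemma mcoefE n (r : mrep n) u v x : mcoef r u v x = (u *m rho r x *m v) 0 0.
Proof.
rewrite /mcoef regf_sum mxE.
under eq_bigr do rewrite regf_sum.
rewrite exchange_big /=; apply: eq_bigr => j _.
rewrite mxE mulr_suml; apply: eq_bigr => i _.
by rewrite rhoE [RHS]mulrAC.
Qed.
End RegularFunctions.

(** * Characteristic zero: rational scalars and rational-valued functionals *)

Section CharZero.
Variables (k : fieldType) (char0 : [pchar k] =i pred0).

Lemma natk_neq0 n : (n.+1%:R : k) != 0.
Proof. by rewrite ((pcharf0P k).1 char0). Qed.

Lemma natk_eq0 n : ((n%:R : k) == 0) = (n == 0%N).
Proof. exact: (pcharf0P k).1 char0 n. Qed.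

Lemma intk_eq0 (z : int) : ((z%:~R : k) == 0) = (z == 0).
Proof.
by case: z => n; rewrite ?NegzE ?mulrNz ?oppr_eq0 ?natk_eq0 -?pmulrn ?natk_eq0.
Qed.

Lemma poly_nat_eq0 (p : {poly k}) : (forall n : nat, p.[n%:R] = 0) -> p = 0.
Proof.
move=> p0; apply: (@roots_geq_poly_eq0 _ p [seq i%:R | i <- iota 0 (size p)]).
- by apply/allP => _ /mapP[i _ ->]; rewrite rootE p0.
- rewrite map_inj_uniq ?iota_uniq // => m n.
  wlog le_mn : m n / (m <= n)%N => [W|/eqP].
    by case: (leqP m n) => [/W //|/ltnW /W {}W /esym /W].
  rewrite eq_sym -subr_eq0 -natrB // natk_eq0 subn_eq0 => le_nm.
  by apply/eqP; rewrite eqn_leq le_mn.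
- by rewrite size_map size_iota.
Qed.

Lemma ratr_den (x : rat) : (ratr x : k) * (denq x)%:~R = (numq x)%:~R.
Proof. by rewrite /ratr mulfVK // intk_eq0 denq_neq0. Qed.

Lemma ratr_eq (x : rat) (y : k) (n d : int) : d != 0 ->
  x * d%:~R = n%:~R -> y * d%:~R = n%:~R -> ratr x = y.
Proof.
move=> d0 xE yE.
have e : numq x * d = n * denq x.
  apply: (@intr_inj rat); rewrite !rmorphM /= numqE -xE; ring.
have dk : (d%:~R : k) != 0 by rewrite intk_eq0.
have Dk : ((denq x)%:~R : k) != 0 by rewrite intk_eq0 denq_neq0.
apply: (mulIf Dk); apply: (mulIf dk).
by rewrite ratr_den -intrM e intrM -yE mulrAC.
Qed.

Lemma ratr_addk (x y : rat) : (ratr (x + y) : k) = ratr x + ratr y.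
Proof.
apply: (@ratr_eq _ _ (numq x * denq y + numq y * denq x) (denq x * denq y)).
- by rewrite mulf_neq0 ?denq_neq0.
- rewrite !(rmorphD, rmorphM) /= !numqE; ring.
- rewrite !(rmorphD, rmorphM) /= -!ratr_den; ring.
Qed.

Lemma ratr_mulk (x y : rat) : (ratr (x * y) : k) = ratr x * ratr y.
Proof.
apply: (@ratr_eq _ _ (numq x * numq y) (denq x * denq y)).
- by rewrite mulf_neq0 ?denq_neq0.
- rewrite !rmorphM /= !numqE; ring.
- rewrite !rmorphM /= -!ratr_den; ring.
Qed.

Lemma ratr0k : (ratr 0 : k) = 0.
Proof. by rewrite (_ : 0 = 0%:R) // ratr_nat. Qed.

Lemma ratr1k : (ratr 1 : k) = 1.
Proof. by rewrite (_ : 1 = 1%:R) // ratr_nat. Qed.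

Local Open Scope classical_set_scope.

(** A rational subspace [W] maximal among those avoiding [a] is a complement of the rational line
    through [a]; [phi] reads the coordinate along that line. *)
Lemma rational_functional (a : k) : a != 0 ->
  exists phi : k -> rat, [/\ forall x y, phi (x + y) = phi x + phi y,
    forall q x, phi (ratr q * x) = q * phi x & phi a = 1].
Proof.
move=> a0.
pose P (W : set k) := [/\ forall x y, W x -> W y -> W (x + y),
  forall q x, W x -> W (ratr q * x) & ~ W a].
have [F FP Ftot|W [[WD WZ Wa] Wmax]] := @Zorn_bigcup k P.
  split=> [x y [A FA Ax] [B FB By]|q x [A FA Ax]|[A FA Aa]].
  - by case: (Ftot _ _ FA FB) => [AB|BA];
      [exists B => //; have [BD _ _] := FP _ FB; apply: BD => //; exact: AB
      |exists A => //; have [AD _ _] := FP _ FA; apply: AD => //; exact: BA].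
  - by exists A => //; have [_ AZ _] := FP _ FA; apply: AZ.
  - by have [_ _] := FP _ FA; apply.
(* The empty set also satisfies [P]; maximality compared with the zero subspace excludes it. *)
have W0 : W 0.
  have [[w Ww]|nW] := pselect (exists w, W w).
    by have := WZ 0 w Ww; rewrite ratr0k mul0r.
  exfalso; apply: (Wmax [set 0]).
    split; first by move=> x Wx; case: nW; exists x.
    by move=> /(_ 0 erefl) W0; apply: nW; exists 0.
  split=> [x y -> ->|q x ->|/eqP]; rewrite ?addr0 ?mulr0 //=.
  by rewrite (negbTE a0).
have ex x : exists q, W (x - ratr q * a).
  have [Wx|nWx] := pselect (W x).
    by exists 0; rewrite ratr0k mul0r subr0.
  (* The span of [W] and [x]. By maximality it contains [a], and the relation can be solved for [x]
     because [a] is not in [W]. *)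
  pose W' : set k := [set y | exists q, W (y - ratr q * x)].
  have W'D y z : W' y -> W' z -> W' (y + z).
    move=> [q Wq] [r Wr]; exists (q + r).
    by have := WD _ _ Wq Wr; rewrite ratr_addk; congr W; ring.
  have W'Z q y : W' y -> W' (ratr q * y).
    move=> [r Wr]; exists (q * r).
    by have := WZ q _ Wr; rewrite ratr_mulk; congr W; ring.
  have WW' y : W y -> W' y by exists 0; rewrite ratr0k mul0r subr0.
  have W'x : W' x by exists 1; rewrite ratr1k mul1r subrr.
  have [[q Wq]|nW'a] := pselect (W' a).
    have [q0|q0] := eqVneq q 0.
      by case: Wa; move: Wq; rewrite q0 ratr0k mul0r subr0.
    exists q^-1; have := WZ (- q^-1) _ Wq; congr W.
    have e : ratr q^-1 * ratr q = 1 :> k by rewrite -ratr_mulk mulVf ?ratr1k.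
    have -> : ratr (- q^-1) = - ratr q^-1 :> k.
      by apply: (addrI (ratr q^-1)); rewrite -ratr_addk !subrr ratr0k.
    by rewrite mulrBr !mulNr opprK mulrA e mul1r addrC.
  exfalso; apply: (Wmax W') => //.
  by split=> [|/(_ x W'x)].
have uniq x q r : W (x - ratr q * a) -> W (x - ratr r * a) -> q = r.
  move=> Wq Wr; apply/eqP; rewrite -subr_eq0; apply/negP => /negP qr.
  have := WD _ _ Wr (WZ (-1) _ Wq).
  have N1 : ratr (-1) = -1 :> k.
    by apply: (addrI 1); rewrite -{1}ratr1k -ratr_addk !subrr ratr0k.
  move=> /(WZ (q - r)^-1); apply: contra_not Wa; congr W.
  have -> : x - ratr r * a + ratr (-1) * (x - ratr q * a) = ratr (q - r) * a.
    by rewrite ratr_addk -[- r]mulN1r ratr_mulk N1; ring.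
  by rewrite mulrA -ratr_mulk mulVf ?ratr1k ?mul1r.
have [phi phiP] := choice ex.
exists phi; split=> [x y|q x|].
- apply: (uniq (x + y)) => //.
  by have := WD _ _ (phiP x) (phiP y); rewrite ratr_addk; congr W; ring.
- apply: (uniq (ratr q * x)) => //.
  by have := WZ q _ (phiP x); rewrite ratr_mulk; congr W; ring.
- by apply: (uniq a) => //; rewrite ratr1k mul1r subrr.
Qed.

End CharZero.

(** * Traces, eigenvalues and nilpotency over an algebraically closed field *)

Section MatrixTraces.
Variable (k : closedFieldType).

Lemma trig_mul n (A B : 'M[k]_n) : is_trig_mx A -> is_trig_mx B ->
  is_trig_mx (A *m B) /\ forall i, (A *m B) i i = A i i * B i i.
Proof.
move=> /is_trig_mxP At /is_trig_mxP Bt; split.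
  apply/is_trig_mxP => i j ij; rewrite mxE big1 // => l _.
  have [il|li] := ltnP i l; first by rewrite At ?mul0r.
  by rewrite Bt ?mulr0 // (leq_ltn_trans li).
move=> i; rewrite mxE (bigD1 i) //= big1 ?addr0 // => l li.
have [il|il|/val_inj e] := ltngtP i l; first by rewrite At ?mul0r.
  by rewrite Bt ?mulr0.
by rewrite e eqxx in li.
Qed.

Lemma trig_horner n (A : 'M[k]_n.+1) p : is_trig_mx A ->
  is_trig_mx (horner_mx A p) /\ forall i, horner_mx A p i i = p.[A i i].
Proof.
move=> At; elim/poly_ind: p => [|p c [IHt IHd]].
  by rewrite rmorph0; split=> [|i]; rewrite ?mx0_is_trig // !mxE horner0.
have [Tt Td] := trig_mul IHt At.
rewrite rmorphD rmorphM /= horner_mx_X horner_mx_C -mulmxE.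
split=> [|i]; last by rewrite !mxE eqxx mulr1n hornerMXaddC -IHd -Td mxE.
apply/is_trig_mxP => i j ij; rewrite mxE (is_trig_mxP Tt) //.
by rewrite (is_trig_mxP (scalar_mx_is_trig n.+1 c)) // addr0.
Qed.

Lemma row_complete n (u : 'rV[k]_(1 + n)) : u != 0 ->
  exists2 P : 'M[k]_(1 + n), P \in unitmx & usubmx P = u.
Proof.
move=> u0; pose e : 'M[k]_(1, 1 + n) := row_mx 1%:M 0.
have eE (Q : 'M[k]_(1 + n)) : e *m Q = usubmx Q.
  by rewrite -[Q in LHS]vsubmxK mul_row_col mul1mx mul0mx addr0.
have [|P Pu ePf] := @complete_unitmx _ 1 (1 + n) e (col_mx u 0).
  rewrite eE col_mxKu !rank_rV u0; case: eqP => // /matrixP/(_ 0 (lshift n 0)).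
  by rewrite row_mxEl !mxE eqxx => /eqP; rewrite oner_eq0.
by exists P => //; rewrite -eE -ePf eE col_mxKu.
Qed.

(** A left eigenvector taken as first row of [P] makes the upper right block of the conjugate
    vanish; induction applies to the lower right block. *)
Lemma trigonalizable n (A : 'M[k]_n) :
  exists2 P : 'M[k]_n, P \in unitmx & is_trig_mx (P *m A *m invmx P).
Proof.
elim: n A => [|n IH] A.
  by exists 1%:M; rewrite ?unitmx1 //; apply/is_trig_mxP => [] [].
have /closed_rootP[a] : size (char_poly A) != 1%N by rewrite size_char_poly.
rewrite -eigenvalue_root_char => /eigenvalueP[u uA u0].
have [P Pu Pe] := @row_complete n u u0.
pose B : 'M[k]_(1 + n) := P *m (A : 'M_(1 + n)) *m invmx P.
have [Q Qu Qt] := IH (drsubmx B).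
pose R : 'M[k]_(1 + n) := block_mx 1%:M 0 0 Q.
have Ru : R \in unitmx by rewrite unitmxE det_ublock det1 mul1r -unitmxE.
have RV : invmx R = block_mx 1%:M 0 0 (invmx Q).
  apply: (can_inj (mulKmx Ru)); rewrite mulmxV //.
  rewrite mulmx_block !mul1mx !mul0mx !mulmx0 !addr0 !add0r mulmxV //.
  by rewrite -scalar_mx_block.
have ur0 : ursubmx B = 0.
  have uB : usubmx B = a *: row_mx 1%:M 0.
    rewrite /B -mulmxA.
    have -> : usubmx (P *m (A *m invmx P)) = usubmx P *m (A *m invmx P).
      rewrite -{1}[P]vsubmxK mul_col_mx col_mxKu //.
    rewrite Pe mulmxA uA -scalemxAl -Pe; congr (_ *: _).
    have <- : usubmx (1%:M : 'M[k]_(1 + n)) = row_mx 1%:M 0.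
      by rewrite scalar_mx_block /block_mx col_mxKu.
    rewrite -(mulmxV Pu) -{3}[P]vsubmxK mul_col_mx col_mxKu //.
  by rewrite /ursubmx uB linearZ /= row_mxKr scaler0.
exists (R *m P); first by rewrite unitmx_mul Ru.
have VE : invmx (R *m P) = invmx P *m invmx R.
  apply: (can_inj (mulKmx (_ : R *m P \in unitmx))).
    by rewrite unitmx_mul Ru.
  by rewrite mulmxV ?unitmx_mul ?Ru // mulmxA -(mulmxA R) mulmxV // mulmx1 mulmxV.
have -> : R *m P *m A *m invmx (R *m P) = R *m B *m invmx R.
  by rewrite VE /B !mulmxA.
rewrite RV -[B]submxK ur0 !mulmx_block.
rewrite ?mul1mx ?mul0mx ?mulmx0 ?addr0 ?add0r ?mulmx1 ?mulmx0 ?addr0 ?add0r.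
 rewrite ?mul0mx; apply: etrans (@is_trig_block_mx k 1 n 1 n _ _ _ _ erefl) _.
by rewrite eqxx /= Qt andbT mx11_is_trig.
Qed.

Lemma horner_mx_conj n (P A : 'M[k]_n.+1) p : P \in unitmx ->
  horner_mx (P *m A *m invmx P) p = P *m horner_mx A p *m invmx P.
Proof.
move=> Pu; elim/poly_ind: p => [|p c IH].
  by rewrite !rmorph0 mulmx0 mul0mx.
rewrite !rmorphD !rmorphM /= !horner_mx_X !horner_mx_C IH -!mulmxE.
rewrite mulmxDr mulmxDl !mulmxA mulmxKV //; congr (_ + _).
by rewrite -scalemx1 -scalemxAr mulmx1 -scalemxAl mulmxV.
Qed.

(** The list [s] is the diagonal of a triangular form, that is, the eigenvalues with
    multiplicity. *)
Lemma trace_horner n (A : 'M[k]_n.+1) :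
  exists s : seq k, [/\ horner_mx A (\prod_(a <- s) ('X - a%:P)) = 0,
    size s = n.+1, forall a, a \in s -> eigenvalue A a
    & forall p, \tr (horner_mx A p) = \sum_(a <- s) p.[a]].
Proof.
have [P Pu Tt] := trigonalizable A; set T := P *m A *m _ in Tt.
exists [seq T i i | i <- enum 'I_n.+1].
have AE p : horner_mx A p = invmx P *m horner_mx T p *m P.
  by rewrite horner_mx_conj // !mulmxA mulVmx // mul1mx mulmxKV.
have cT : char_poly T = \prod_(a <- [seq T i i | i <- enum 'I_n.+1]) ('X - a%:P).
  by rewrite big_map big_enum -char_poly_trig.
split=> [||a|p]; last 1 first.
- rewrite big_map big_enum AE mxtrace_mulC mulmxA mulmxV // mul1mx.
  by apply: eq_bigr => i _; rewrite (trig_horner p Tt).2.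
- by rewrite AE -cT Cayley_Hamilton mulmx0 mul0mx.
- by rewrite size_map size_enum_ord.
rewrite -root_prod_XsubC -cT -eigenvalue_root_char => /eigenvalueP[u uT u0].
apply/eigenvalueP; exists (u *m P).
  by rewrite scalemxAl -uT /T -!mulmxA mulVmx // mulmx1.
by apply: contra_neq u0 => /(congr1 (mulmx^~ (invmx P))); rewrite mulmxK // mul0mx.
Qed.

Lemma eigenvalue_nilp n (A : 'M[k]_n.+1) N a : A ^+ N = 0 -> eigenvalue A a -> a = 0.
Proof.
move=> AN /eigenvalueP[u uA u0].
have : u *m A ^+ N = a ^+ N *: u.
  elim: N {AN} => [|N IH]; first by rewrite expr0 mulmx1 scale1r.
  by rewrite exprSr mulmxA IH -scalemxAl uA scalerA exprSr.
rewrite AN mulmx0 => /esym/eqP; rewrite scaler_eq0 (negbTE u0) orbF.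
by rewrite expf_eq0 => /andP[_ /eqP].
Qed.

Lemma trace_nilp n (A : 'M[k]_n.+1) N : A ^+ N = 0 -> \tr A = 0.
Proof.
move=> AN; have [s [_ _ sE /(_ 'X)]] := trace_horner A.
rewrite horner_mx_X => ->; rewrite big_seq big1 // => a /sE/(eigenvalue_nilp AN).
by rewrite hornerX.
Qed.

Lemma nilp_of_eigenvalues n (A : 'M[k]_n.+1) (s : seq k) :
  horner_mx A (\prod_(a <- s) ('X - a%:P)) = 0 -> size s = n.+1 ->
  (forall a, a \in s -> a = 0) -> A ^+ n.+1 = 0.
Proof.
move=> sE ss s0; move: sE; rewrite big_seq.
rewrite (eq_bigr (fun=> 'X)) => [|a /s0 ->]; last by rewrite subr0.
rewrite -big_seq big_const_seq iter_mulr_1.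
by rewrite count_predT ss rmorphXn /= horner_mx_X.
Qed.

Variable char0 : [pchar k] =i pred0.

(** If [a] is a nonzero eigenvalue and [q] vanishes at all the others, the trace of [A q(A)] is the
    multiplicity of [a] times [a * q.[a]], which is nonzero in characteristic 0. *)
Lemma nilp_of_traces n (A : 'M[k]_n.+1) :
  (forall j, \tr (A ^+ j.+1) = 0) -> A ^+ n.+1 = 0.
Proof.
move=> trA; have [s [sC ss _ sE]] := trace_horner A.
apply: (nilp_of_eigenvalues sC ss) => a sa; apply: contraTeq isT => a0.
have tr0 p : \tr (horner_mx A ('X * p)) = 0.
  rewrite -[p]coefK poly_def mulr_sumr !raddf_sum big1 //= => i _.
  by rewrite -scalerAr -exprS linearZ /= rmorphXn /= horner_mx_X mxtraceZ trA mulr0.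
pose q : {poly k} := \prod_(b <- [seq b <- s | b != a]) ('X - b%:P).
have qE b : (q.[b] == 0) = (b \in [seq b <- s | b != a]).
  by rewrite -root_prod_XsubC.
have := tr0 q; rewrite sE (bigID (pred1 a)) /= [X in _ + X]big_seq_cond.
rewrite [X in _ + X]big1 => [|b /andP[sb ba]]; last first.
  rewrite hornerM (eqP (_ : q.[b] == 0)) ?mulr0 //.
  by rewrite qE mem_filter ba.
rewrite addr0 (eq_bigr (fun=> a * q.[a])) => [|b /eqP ->]; last first.
  by rewrite hornerM hornerX.
rewrite big_const_seq iter_addr_0 => /eqP.
rewrite -mulr_natr !mulf_eq0 (negbTE a0) qE mem_filter eqxx /=.
by rewrite (natk_eq0 char0) -(negbK (_ == _)) -lt0n -has_count has_pred1 sa.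
Qed.
End MatrixTraces.

(** Chinese remainders: each new point adds a Bezout correction divisible by the moduli already
    treated. For [N] large, [p] acts on the generalized eigenspace for [a] as the scalar [f a]. *)
Lemma poly_crt (k : fieldType) (f : k -> k) N (s : seq k) :
  exists p : {poly k}, forall a, a \in s -> ('X - a%:P) ^+ N %| p - (f a)%:P.
Proof.
elim: s => [|b s [p pP]]; first by exists 0.
have [bs|bs] := boolP (b \in s).
  by exists p => a; rewrite inE => /predU1P[->|]; apply: pP.
pose B : {poly k} := \prod_(a <- s) ('X - a%:P) ^+ N.
have cop : coprimep B (('X - b%:P) ^+ N).
  apply: coprimep_expr; rewrite coprimep_XsubC rootE horner_prod.
  rewrite prodf_seq_neq0; apply/allP => a sa /=.
  rewrite hornerE expf_neq0 // hornerXsubC subr_eq0.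
  by apply: contraNneq bs => ->.
have /Bezout_eq1_coprimepP[[u v] /= uv] := cop.
exists (p + B * (u * ((f b)%:P - p))) => a; rewrite inE => /predU1P[->|sa].
  have -> : p + B * (u * ((f b)%:P - p)) - (f b)%:P
            = (v * ('X - b%:P) ^+ N) * (p - (f b)%:P).
    have -> : v * ('X - b%:P) ^+ N = 1 - u * B by rewrite -uv; ring.
    ring.
  by rewrite mulrAC dvdp_mulIr.
rewrite addrAC; apply: dvdp_add; first exact: pP.
by apply: dvdp_mulr; rewrite /B (big_rem _ sa) /= dvdp_mulr.
Qed.

(** * Cartan's criterion for nilpotency *)

Section Replicas.
Variables (k : closedFieldType) (char0 : [pchar k] =i pred0).

(* Cartan's criterion: the trace condition reads [\sum_a a * phi a = 0] over the
   eigenvalues, and applying [phi] again turns it into a sum of rational squares. *)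
Lemma nilp_of_replicas n (X : 'M[k]_n.+1) :
  (forall phi : k -> rat, (forall x y, phi (x + y) = phi x + phi y) ->
     (forall q x, phi (ratr q * x) = q * phi x) ->
     exists2 p, (forall a, eigenvalue X a -> p.[a] = ratr (phi a))
              & \tr (X *m horner_mx X p) = 0) ->
  X ^+ n.+1 = 0.
Proof.
move=> hX; have [s [sC ss sE str]] := trace_horner X.
apply: (nilp_of_eigenvalues sC ss) => a sa; apply: contraTeq isT => a0.
have [phi [phiD phiZ phia]] := rational_functional char0 a0.
have [p pP] := hX phi phiD phiZ.
have -> : X *m horner_mx X p = horner_mx X ('X * p).
  by rewrite rmorphM /= horner_mx_X mulmxE.
rewrite str big_seq (eq_bigr (fun b => ratr (phi b) * b)); last first.
  by move=> b sb; rewrite hornerM hornerX pP ?sE // mulrC.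
rewrite -big_seq => /(congr1 phi).
have phi0 : phi 0 = 0 by have := phiZ 0 0; rewrite mulr0 mul0r.
rewrite phi0 (big_morph phi phiD phi0) (eq_bigr (fun b => phi b ^+ 2)); last first.
  by move=> b _; rewrite phiZ.
move=> /eqP; rewrite Num.Theory.psumr_eq0 => [/allP/(_ a sa)|b _]; last exact: Num.Theory.sqr_ge0.
by rewrite /= phia expr1n.
Qed.
End Replicas.

(** * Subspaces given by predicates *)

Section Subspaces.
Variables (k : fieldType) (V : vectType k).

(** A subspace of maximal dimension inside [S] is all of [S]. This turns images of spaces of
    derivations, described by existential statements, into objects with a dimension and a basis. *)
Lemma vspace_of_set (S : V -> Prop) : S 0 ->
  (forall c u v, S u -> S v -> S (c *: u + v)) ->
  exists U : {vspace V}, forall v, v \in U <-> S v.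
Proof.
move=> S0 SD.
pose good d := `[< exists2 U : {vspace V}, (forall v, v \in U -> S v) & \dim U = d >].
have g0 : exists d, good d.
  exists 0%N; apply/asboolP; exists 0%VS; rewrite ?dimv0 //.
  by move=> v; rewrite memv0 => /eqP ->.
have gb d : good d -> (d <= \dim {:V})%N.
  by move=> /asboolP[U _ <-]; apply/dimvS/subvf.
case: (ex_maxnP g0 gb) => d /asboolP[U US Ud] Umax.
exists U => v; split=> [/US //|Sv].
have : good (\dim (U + <[v]>)%VS).
  apply/asboolP; exists (U + <[v]>)%VS => // w /memv_addP[x Ux [_ /vlineP[c ->] ->]].
  by rewrite addrC; apply: SD => //; apply: US.
move=> /Umax; rewrite -Ud => dle.
have /eqP -> : U == (U + <[v]>)%VS by rewrite eqEdim addvSl.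
by rewrite -{1}[v]add0r memv_add ?mem0v ?memv_line.
Qed.
End Subspaces.

(** * Engel's theorem for spaces of nilpotent matrices *)

Section Engel.
Variables (k : fieldType) (n : nat).
Implicit Types (T L : {vspace 'M[k]_n}) (x y t : 'M[k]_n) (v : 'rV[k]_n).

(* The ascending central series of the row space under T. *)
Fixpoint ann T p v : Prop :=
  if p is p'.+1 then forall t, t \in T -> ann T p' (v *m t) else v = 0.

Lemma annD T p u v : ann T p u -> ann T p v -> ann T p (u + v).
Proof.
elim: p u v => [|p IH] u v /=; first by move=> -> ->; rewrite addr0.
by move=> hu hv t Tt; rewrite mulmxDl; apply: IH; [apply: hu|apply: hv].
Qed.

Lemma annZ T p c v : ann T p v -> ann T p (c *: v).
Proof.
elim: p v => [|p IH] v /=; first by move=> ->; rewrite scaler0.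
by move=> hv t Tt; rewrite -scalemxAl; apply/IH/hv.
Qed.

Lemma annN T p v : ann T p v -> ann T p (- v).
Proof. by rewrite -scaleN1r; apply: annZ. Qed.

Lemma ann0 T p : ann T p 0.
Proof. by elim: p => [|p IH] //= t Tt; rewrite mul0mx. Qed.

Lemma annS T p v : ann T p v -> ann T p.+1 v.
Proof.
elim: p v => [|p IH] v; first by move=> -> t _ /=; rewrite mul0mx.
by move=> hv t Tt; apply/IH/hv.
Qed.

Lemma ann_leq T p q v : (p <= q)%N -> ann T p v -> ann T q v.
Proof. by move=> /subnK <-; elim: (q - p)%N => [|i IH] // /IH /annS. Qed.

Lemma ann_stable T p g v :
  (forall t, t \in T -> exists2 s, s \in T & g *m t = s *m g) ->
  ann T p v -> ann T p (v *m g).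
Proof.
move=> gT; elim: p v => [|p IH] v /=; first by move=> ->; rewrite mul0mx.
move=> hv t Tt; have [s Ts gts] := gT t Tt.
by rewrite -mulmxA gts mulmxA; apply/IH/hv.
Qed.

Lemma ann_normalized T p x v :
  (forall t, t \in T -> x *m t - t *m x \in T) -> ann T p v -> ann T p (v *m x).
Proof.
move=> xT; elim: p v => [|p IH] v /=; first by move=> ->; rewrite mul0mx.
move=> hv t Tt.
have -> : v *m x *m t = v *m t *m x + v *m (x *m t - t *m x).
  by rewrite mulmxBr !mulmxA addrC subrK.
by apply: annD; [apply/IH/hv|apply/hv/xT].
Qed.

Definition ann_full T := exists p, forall v, ann T p v.

(** Each step of the series of [T] is refined by the powers of [x], which preserve it because [x]
    normalizes [T]. One step thus costs [m] steps for [T + <[x]>]. *)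
Lemma ann_full_add T x m : (forall t, t \in T -> x *m t - t *m x \in T) ->
  (forall v, v *m iter m (mulmx x) 1%:M = 0) ->
  ann_full T -> ann_full (T + <[x]>).
Proof.
move=> xT xm [P TP].
pose xp j := iter j (mulmx x) 1%:M.
have xpS j : xp j.+1 = xp j *m x.
  by elim: j => [|j IH]; rewrite /xp /= ?mulmx1 ?mul1mx // -mulmxA -IH.
suff main p v : ann T p v -> ann (T + <[x]>) (p * m) v.
  by exists (P * m)%N => v; apply/main/TP.
elim: p v => [|p IH] v hv; first by rewrite mul0n.
(* Descent on the power of [x]: multiplying by [x] lowers [j] by one, and multiplying by an element
   of [T] drops to level [p] of the old series. *)
suff down j : (j <= m)%N -> ann (T + <[x]>) (p * m + j) (v *m xp (m - j)%N).
  by have := down m (leqnn m); rewrite subnn /xp /= mulmx1 mulSn addnC.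
elim: j => [|j IHj] jm; first by rewrite subn0 xm; apply: ann0.
rewrite addnS /= => _ /memv_addP[t Tt [_ /vlineP[c ->] ->]].
rewrite mulmxDr -scalemxAr; apply: annD; last first.
  by apply: annZ; rewrite -mulmxA -xpS -subSn // subSS; apply/IHj/ltnW.
apply: (ann_leq (leq_addr _ _)); apply: IH.
have hxp i : ann T p.+1 (v *m xp i).
  elim: i => [|i IHi]; first by rewrite /xp /= mulmx1.
  by rewrite xpS mulmxA; apply: ann_normalized.
exact: hxp.
Qed.

(** Of the two terms of a bracket, one lowers the level of the output and the other that of the
    input. The output can drop [P] times and the input [P] times, hence [P + P]. *)
Lemma iter_bracket_level T P (f : nat -> 'M[k]_n) :
  (forall v, ann T P v) ->
  (forall i, exists2 t, t \in T & f i.+1 = f i *m t - t *m f i) ->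
  f (P + P)%N = 0.
Proof.
move=> TP fS.
have lev j i v : ann T i v -> ann T (i + P - j) (v *m f j).
  elim: j i v => [|j IH] i v hv; first by apply: ann_leq (TP _); rewrite subn0 leq_addl.
  have [t Tt ->] := fS j; rewrite mulmxBr !mulmxA; apply: annD.
    have := IH i v hv; case E: (i + P - j)%N => [|q].
      by move=> /= ->; rewrite mul0mx; apply: ann0.
    by move=> /= /(_ t Tt); rewrite subnS E.
  apply: annN; case: i hv => [|i] hv.
    by move: hv => /= ->; rewrite !mul0mx; apply: ann0.
  by rewrite addSn subSS; apply: IH; apply: hv.
apply/row_matrixP => i; rewrite row0 rowE.
by have := lev (P + P)%N P (delta_mx 0 i) (TP _); rewrite subnn.
Qed.

Lemma engel L : (forall x y, x \in L -> y \in L -> x *m y - y *m x \in L) ->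
  (forall x, x \in L -> exists m, forall v, v *m iter m (mulmx x) 1%:M = 0) ->
  ann_full L.
Proof.
move=> Lb Ln.
pose good d := `[< exists T, [/\ (T <= L)%VS, ann_full T,
  (forall x y, x \in T -> y \in T -> x *m y - y *m x \in T) & \dim T = d] >].
have g0 : exists d, good d.
  exists 0%N; apply/asboolP; exists 0%VS; split; rewrite ?dimv0 ?sub0v //.
    by exists 1%N => v t; rewrite memv0 => /eqP ->; rewrite mulmx0.
  by move=> x y; rewrite !memv0 => /eqP -> /eqP ->; rewrite mulmx0 subrr.
have gb d : good d -> (d <= \dim L)%N.
  by move=> /asboolP[T [TL _ _ <-]]; apply: dimvS.
case: (ex_maxnP g0 gb) => d /asboolP[T [TL [P TP] Tb Td]] Tmax.
have [LT|/subvPn[x0 Lx0 Tx0]] := boolP (L <= T)%VS.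
  have -> : L = T by apply/eqP; rewrite eqEsubv LT.
  by exists P.
(* Otherwise every element of [L] outside [T] has a bracket with [T] that is again outside [T].
   Iterating gives a sequence that never meets [T], although its term [P + P] is 0. The element [x]
   found here enlarges the maximal [T]. *)
exfalso; have [x [Lx Tx xT]] : exists x, [/\ x \in L, x \notin T &
    forall t, t \in T -> x *m t - t *m x \in T].
  apply: contrapT => nx.
  have step (z : {z | z \in L /\ z \notin T}) :
      exists z' : {z | z \in L /\ z \notin T},
      exists2 t, t \in T & sval z' = sval z *m t - t *m sval z.
    case: z => z [Lz Tz] /=; apply: contrapT => nz; apply: nx; exists z; split=> //.
    move=> t Tt; apply/negP => /negP nT; apply: nz.
    have Lz' : z *m t - t *m z \in L by apply: Lb => //; apply: (subvP TL).
    by exists (exist _ (z *m t - t *m z) (conj Lz' nT)); exists t.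
  have [F FP] := choice step.
  pose f i := sval (iter i F (exist _ x0 (conj Lx0 Tx0))).
  have : f (P + P)%N = 0.
    by apply: (iter_bracket_level TP) => i; exact: FP.
  rewrite /f; case: (iter _ _ _) => z [_ /= Tz] z0.
  by rewrite z0 mem0v in Tz.
have [m xm] := Ln x Lx.
have : good (\dim (T + <[x]>)%VS).
  apply/asboolP; exists (T + <[x]>)%VS; split=> //.
  - by rewrite subv_add TL -memvE.
  - by apply: ann_full_add xm _ => //; exists P.
  move=> _ _ /memv_addP[s Ts [_ /vlineP[a ->] ->]] /memv_addP[t Tt [_ /vlineP[b ->] ->]].
  apply: (subvP (addvSl T <[x]>)).
  have -> : (s + a *: x) *m (t + b *: x) - (t + b *: x) *m (s + a *: x) =
      (s *m t - t *m s) + a *: (x *m t - t *m x) - b *: (x *m s - s *m x).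
    rewrite !mulmxDr !mulmxDl -!scalemxAl -!scalemxAr.
    move: (s *m t) (t *m s) (s *m x) (x *m s) (x *m t) (t *m x) (x *m x).
    by move=> A B C D E F K; apply/matrixP => i j; rewrite !mxE; ring.
  apply: memvB; last exact/memvZ/xT.
  by apply: memvD; [apply: Tb|apply/memvZ/xT].
move=> /Tmax; rewrite -Td => dle.
have /eqP e : T == (T + <[x]>)%VS by rewrite eqEdim addvSl.
by move: Tx; rewrite e -{1}[x]add0r memv_add ?mem0v ?memv_line.
Qed.
End Engel.

(** * Nondegenerate trace forms: orthogonal projection and Casimir operator *)

Section TraceForm.
Variables (k : fieldType) (n : nat) (V : {vspace 'M[k]_n}).
Hypothesis V_nondeg :
  forall x, x \in V -> (forall y, y \in V -> \tr (x *m y) = 0) -> x = 0.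

Let d := \dim V.
Let b (i : 'I_d) : 'M[k]_n := (vbasis V)`_i.
Let gram : 'M[k]_d := \matrix_(i, j) \tr (b i *m b j).

Let bV i : b i \in V.
Proof. by apply/vbasis_mem/mem_nth; rewrite size_tuple. Qed.

Let b_span x : x \in V -> exists c : 'rV_d, x = \sum_i c 0 i *: b i.
Proof.
move=> Vx; exists (\row_i coord (vbasis V) i x).
by rewrite {1}(coord_vbasis Vx); apply: eq_bigr => i _; rewrite mxE.
Qed.

Let trace_span (c : 'rV_d) j : \tr ((\sum_i c 0 i *: b i) *m b j) = (c *m gram) 0 j.
Proof.
rewrite mulmx_suml raddf_sum mxE; apply: eq_bigr => i _.
by rewrite -scalemxAl /= mxtraceZ mxE.
Qed.

Let orthP x : (forall j, \tr (x *m b j) = 0) -> forall y, y \in V -> \tr (x *m y) = 0.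
Proof.
move=> xb y /b_span[c ->]; rewrite mulmx_sumr raddf_sum big1 // => j _.
by rewrite -scalemxAr /= mxtraceZ xb mulr0.
Qed.

Let gram_unit : gram \in unitmx.
Proof.
rewrite -row_free_unit; apply/row_freeP.
suff /inj_row_free : forall c : 'rV_d, c *m gram = 0 -> c = 0.
  by move=> /row_freeP.
move=> c cG; have V0 : \sum_i c 0 i *: b i = 0.
  apply: V_nondeg; first by apply: memv_suml => i _; apply/memvZ/bV.
  by apply: orthP => j; rewrite trace_span cG mxE.
have /freeP := basis_free (vbasisP V) => /(_ (c 0) V0) c0.
by apply/rowP => i; rewrite c0 mxE.
Qed.

Lemma trace_projection x : exists2 z, z \in V &
  forall y, y \in V -> \tr ((x - z) *m y) = 0.
Proof.
pose c := (\row_i \tr (x *m b i)) *m invmx gram.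
exists (\sum_i c 0 i *: b i); first by apply: memv_suml => i _; apply/memvZ/bV.
apply: orthP => j; rewrite mulmxBl raddfB /= trace_span.
by rewrite /c mulmxKV // mxE subrr.
Qed.

(** [C] is the sum of the [D i j *: (b i *m b j)], with [D] the inverse Gram matrix. Conjugation
    preserves the trace form, so its matrix [S] on the basis satisfies [S *m gram *m S^T = gram];
    inverting gives [S^T *m D *m S = D], which is the invariance of [C]. *)
Lemma casimir : exists C : 'M[k]_n,
  [/\ forall w : 'cV_n, (forall y, y \in V -> y *m w = 0) -> C *m w = 0,
      \tr C = (\dim V)%:R
    & forall g h, g *m h = 1%:M -> (forall y, y \in V -> g *m y *m h \in V) ->
        g *m C = C *m g].
Proof.
pose D := invmx gram.
exists (\sum_i \sum_j D i j *: (b i *m b j)); split=> [w Vw||g h gh gV].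
- rewrite mulmx_suml big1 // => i _; rewrite mulmx_suml big1 // => j _.
  by rewrite -scalemxAl -mulmxA Vw ?mulmx0 ?scaler0.
- have -> : (\dim V)%:R = \tr (D *m gram) by rewrite mulVmx // mxtrace1.
  rewrite raddf_sum; apply: eq_bigr => i _; rewrite raddf_sum mxE /=.
  by apply: eq_bigr => j _; rewrite mxtraceZ mxE mxtrace_mulC.
have hg := mulmx1C gh.
have [S SP] : exists S : 'M_d, forall i, g *m b i *m h = \sum_l S i l *: b l.
  have /choice[c cP] i := b_span (gV _ (bV i)).
  exists (\matrix_i c i) => i; rewrite cP; apply: eq_bigr => l _.
  by rewrite !mxE.
have SG : S *m gram *m S^T = gram.
  apply/matrixP => i j.
  have -> : gram i j = \tr ((g *m b i *m h) *m (g *m b j *m h)).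
    rewrite !mulmxA -(mulmxA _ h g) hg mulmx1 mxtrace_mulC !mulmxA hg mul1mx.
    by rewrite mxE.
  rewrite (SP j) mulmx_sumr raddf_sum mxE; apply: eq_bigr => l _.
  rewrite -scalemxAr /= mxtraceZ mulrC [S^T _ _]mxE; congr (_ * _).
  have -> : (S *m gram) i l = (row i S *m gram) 0 l by rewrite -row_mul [RHS]mxE.
  rewrite -trace_span SP; congr (\tr (_ *m _)).
  by apply: eq_bigr => m _; rewrite mxE.
have DS : S^T *m D *m S = D.
  have /mulmx1C e : S *m (gram *m S^T *m D) = 1%:M.
    by rewrite !mulmxA SG mulmxV.
  apply: (can_inj (mulKmx gram_unit)).
  by rewrite !mulmxA e mulmxV.
set C := \sum_i _; suff gCh : g *m C *m h = C by rewrite -[in RHS]gCh -(mulmxA _ h g) hg mulmx1.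
rewrite -[in RHS](_ : \sum_i \sum_j (S^T *m D *m S) i j *: (b i *m b j) = C); last first.
  by rewrite DS.
have -> : g *m C *m h = \sum_i \sum_j \sum_l \sum_m
    (D i j * S i l * S j m) *: (b l *m b m).
  rewrite mulmx_sumr mulmx_suml; apply: eq_bigr => i _.
  rewrite mulmx_sumr mulmx_suml; apply: eq_bigr => j _.
  have -> : g *m (D i j *: (b i *m b j)) *m h
          = D i j *: ((g *m b i *m h) *m (g *m b j *m h)).
    by rewrite -scalemxAr -scalemxAl !mulmxA -(mulmxA _ h g) hg mulmx1.
  rewrite !SP mulmx_suml scaler_sumr; apply: eq_bigr => l _.
  rewrite mulmx_sumr scaler_sumr; apply: eq_bigr => m _.
  by rewrite -scalemxAl -scalemxAr !scalerA.
under eq_bigr do rewrite exchange_big.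
rewrite [LHS]exchange_big.
under eq_bigr do under eq_bigr do rewrite exchange_big.
under eq_bigr do rewrite exchange_big.
apply: eq_bigr => l _; apply: eq_bigr => m _.
rewrite exchange_big mxE scaler_suml; apply: eq_bigr => j _.
rewrite mxE mulr_suml scaler_suml; apply: eq_bigr => i _.
by rewrite !mxE (mulrC (S i l)).
Qed.
End TraceForm.

(** * Regular functions as coefficients of finite-dimensional representations *)

Section MatrixCoefficients.
Variables (k : closedFieldType) (G : algGroup k).
Local Notation regf := (regf G).

(** All the [F a] share the left factors [A], at the price of zeros among the [B a]; the length [N]
    bounds the ranks in [matrix_coefs]. *)
Lemma regf_family_mul m (F : 'I_m -> regf) :
  exists N (A : 'I_N -> regf) (B : 'I_m -> 'I_N -> regf),
  forall a x y, F a (x * y)%g = \sum_(i < N) A i x * B a i y.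
Proof.
have /choice[s sP] (a : 'I_m) : exists s : seq (regf * regf),
    forall x y, F a (x * y)%g = \sum_(p <- s) p.1 x * p.2 y.
  have [n [A [B FAB]]] := regf_mulP (F a).
  exists [seq (A i, B i) | i <- enum 'I_n] => x y.
  by rewrite big_map big_enum FAB.
pose S := [seq (a, p) | a <- enum 'I_m, p <- s a].
pose t (i : 'I_(size S)) := tnth (in_tuple S) i.
exists (size S), (fun i => (t i).2.1), (fun a i => if (t i).1 == a then (t i).2.2 else 0).
move=> a x y; rewrite sP.
transitivity (\sum_(q <- S) q.2.1 x * (if q.1 == a then q.2.2 else 0 : regf) y);
  last by rewrite big_tnth.
rewrite big_allpairs_dep big_enum (bigD1 a) //= eqxx [X in _ + X]big1 ?addr0 // => b ba.
by rewrite (negbTE ba) big1 // => p _; rewrite regf0 mulr0.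
Qed.

(** The scalar required to be nonzero is the Schur complement of [Q]. *)
Lemma unitmx_block n (Q : 'M[k]_n) c r d : Q \in unitmx ->
  (d - r *m invmx Q *m c) 0 0 != 0 -> (block_mx Q c r d : 'M_(n + 1)) \in unitmx.
Proof.
move=> Qu dn.
have -> : block_mx Q c r d = block_mx 1%:M 0 (r *m invmx Q) 1%:M
                             *m block_mx Q c 0 (d - r *m invmx Q *m c).
  rewrite mulmx_block !mul1mx ?mul0mx ?mulmx0 ?addr0 mulmxKV //.
  by rewrite addrC subrK.
rewrite unitmx_mul !unitmxE det_lblock det_ublock !det1 mulr1 unitr1 /=.
by rewrite unitrM -unitmxE Qu det_mx11 unitfE.
Qed.

(* [g] comes from a maximal invertible matrix of the form [F (a j) (g i * h j)]: by
   maximality the translates [F a (g i * _)] span all the left translates. *)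
Lemma matrix_coefs m (F : 'I_m -> regf) a0 : F a0 = 1 ->
  exists n (r : mrep G n.+1) (u : 'rV[k]_n.+1) (g : 'I_n.+1 -> G),
    (forall i, u *m rho r (g i) = delta_mx 0 i) /\
    forall a x, F a x = (u *m rho r x *m \col_i F a (g i)) 0 0.
Proof.
move=> F1.
pose Q n (g h : 'I_n -> G) (a : 'I_n -> 'I_m) : 'M[k]_n :=
  \matrix_(i, j) F (a j) (g i * h j)%g.
pose good n := `[< exists g h a, Q n g h a \in unitmx >].
have g1 : good 1%N.
  apply/asboolP; exists (fun=> 1%g), (fun=> 1%g), (fun=> a0).
  by rewrite unitmxE det_mx11 mxE F1 regf1 unitr1.
have [N [A [B FAB]]] := regf_family_mul F.
have gb n : good n -> (n <= N)%N.
  move=> /asboolP[g [h [a Qu]]]; rewrite -(mxrank_unit Qu).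
  have -> : Q n g h a = (\matrix_(i, l) A l (g i)) *m (\matrix_(l, j) B (a j) l (h j)).
    by apply/matrixP => i j; rewrite !mxE FAB; apply: eq_bigr => l _; rewrite !mxE.
  exact: leq_trans (mxrankM_maxl _ _) (rank_leq_col _).
case: (ex_maxnP (ex_intro good _ g1) gb) => n0 /asboolP[g [h [a Qu]]] nmax.
case: n0 g h a Qu nmax => [|n] g h a Qu nmax; first by have := nmax _ g1.
pose R y : 'rV[k]_n.+1 := \row_j F (a j) (y * h j)%g.
pose coef y := R y *m invmx (Q _ g h a).
have FE b y x : F b (y * x)%g = \sum_i coef y 0 i * F b (g i * x)%g.
  (* The defect of the identity is the Schur complement of the matrix bordered by the row of [y] and
     the column of [b] and [x]; were it nonzero, that matrix would be invertible and larger. *)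
  apply/eqP; rewrite -subr_eq0; apply/negPn/negP => nz.
  have /nmax : good (n.+1 + 1)%N; last by rewrite addn1 ltnn.
  apply/asboolP; exists (fun i : 'I_(n.+1 + 1) => if fintype.split i is inl i then g i else y),
    (fun j : 'I_(n.+1 + 1) => if fintype.split j is inl j then h j else x),
    (fun j : 'I_(n.+1 + 1) => if fintype.split j is inl j then a j else b).
  have -> : Q _ (fun i : 'I_(n.+1 + 1) => if fintype.split i is inl i then g i else y)
      (fun j => if fintype.split j is inl j then h j else x)
      (fun j => if fintype.split j is inl j then a j else b)
    = block_mx (Q _ g h a) (\col_i F b (g i * x)%g) (R y) (F b (y * x)%g)%:M.
    apply/matrixP => i j; rewrite -[i]fintype.splitK -[j]fintype.splitK.
    case: (fintype.split i) => i'; case: (fintype.split j) => j' /=;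
      rewrite ?block_mxEul ?block_mxEur ?block_mxEdl ?block_mxEdr !mxE
        -?[lshift _ _]/(unsplit (inl _)) -?[rshift _ _]/(unsplit (inr _)) !unsplitK //.
    by rewrite !ord1 eqxx mulr1n.
  apply: unitmx_block => //; rewrite !mxE eqxx mulr1n.
  by under eq_bigr do rewrite [X in _ * X]mxE.
have coefg i : coef (g i) = delta_mx 0 i.
  rewrite /coef; have -> : R (g i) = row i (Q _ g h a).
    by apply/rowP => j; rewrite !mxE.
  by rewrite -row_mul mulmxV // row1.
have coefM x y : coef (x * y)%g = coef x *m \matrix_i coef (g i * y)%g.
  have -> : \matrix_i coef (g i * y)%g = (\matrix_i R (g i * y)%g) *m invmx (Q _ g h a).
    by apply/row_matrixP => i; rewrite row_mul !rowK.
  rewrite mulmxA; congr (_ *m _); apply/rowP => j.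
  rewrite mxE -mulgA FE mxE; apply: eq_bigr => i _.
  by rewrite !mxE mulgA.
pose M y : 'M[k]_n.+1 := \matrix_i coef (g i * y)%g.
have [|||r rE] := @mkrep k G n.+1 M.
- move=> i j; have -> : (fun x => M x i j) = (fun x => \sum_l
      invmx (Q _ g h a) l j * ltr (g i) (rtr (h l) (F (a l))) x).
    apply/funext => x; rewrite !mxE; apply: eq_bigr => l _.
    by rewrite !mxE mulrC.
  exact: reg_sumr.
- by apply/row_matrixP => i; rewrite rowK mulg1 coefg row1.
- by move=> x y; apply/row_matrixP => i; rewrite row_mul [LHS]rowK [in RHS]rowK mulgA [LHS]coefM.
exists n, r, (coef 1%g), g; split=> [i|b x].
  by rewrite rE -coefM mul1g coefg.
rewrite rE -coefM mul1g -[x in LHS]mulg1 FE mxE; apply: eq_bigr => i _.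
by rewrite [X in _ = _ * X]mxE mulg1.
Qed.

(** Generation of k[G] as an algebra, phrased as an induction principle to be applied directly to
    properties of regular functions. *)
Definition generating n (r : mrep G n) : Prop := forall B : regf -> Prop,
  (forall c, B (c *: 1)) -> (forall f h, B f -> B h -> B (f + h)) ->
  (forall f h, B f -> B h -> B (f * h)) -> (forall i j, B (rmat r i j)) ->
  forall f, B f.

Lemma mcoef_span n (r : mrep G n) (B : regf -> Prop) u v :
  (forall c, B (c *: 1)) -> (forall f h, B f -> B h -> B (f + h)) ->
  (forall f h, B f -> B h -> B (f * h)) -> (forall i j, B (rmat r i j)) ->
  B (mcoef r u v).
Proof.
move=> Bc BD BM Br; rewrite /mcoef.
have B0 : B 0 by have := Bc 0; rewrite scale0r.
apply: big_ind => // i _; apply: big_ind => // j _.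
by rewrite -[rmat r i j]mul1r scalerAl; apply: BM.
Qed.

(** The algebra generators, joined to the constant 1 that [matrix_coefs] requires, become
    coefficients of one representation. *)
Lemma exists_faithful : exists n (r : mrep G n.+1), generating r.
Proof.
have [m [s [Rs sgen]]] := @reg_fingen k G.
pose F (i : 'I_m.+1) : regf := if unlift ord0 i is Some j then mkregf (Rs j) else 1.
have [|n [r [u [g [_ FE]]]]] := @matrix_coefs _ F ord0.
  by rewrite /F unlift_none.
exists n, r => B Bc BD BM Br f.
pose B' : set (G -> k) := fun h => exists2 b : regf, B b & h = b.
have [||b Bb e] := sgen B' _ _ f (regfP f); last first.
- by have -> : f = b by apply: regf_ext => x; rewrite -e.
- move=> i; exists (mcoef r u (\col_j F (lift ord0 i) (g j))).
    exact: mcoef_span.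
  by apply/funext => x; rewrite mcoefE -FE /F liftK.
split=> [c|_ _ [a Ba ->] [b Bb ->]|_ _ [a Ba ->] [b Bb ->]].
- exists (c *: 1) => //; by apply/funext => x; rewrite regfZ regf1 mulr1.
- by exists (a + b) => //; apply: BD.
- by exists (a * b) => //; apply: BM.
Qed.
End MatrixCoefficients.

(** * Derivations as matrices, and replicas of a point derivation *)

Lemma dvdp_prod_XsubC (k : fieldType) N (s : seq k) (q : {poly k}) : uniq s ->
  (forall b, b \in s -> ('X - b%:P) ^+ N %| q) ->
  \prod_(b <- s) ('X - b%:P) ^+ N %| q.
Proof.
elim: s => [|a s IH] /=; first by rewrite big_nil dvd1p.
move=> /andP[nas us] sq; rewrite big_cons Gauss_dvdp.
  by rewrite sq ?mem_head //= IH // => b sb; rewrite sq // inE sb orbT.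
rewrite coprimep_sym; apply: coprimep_expr; rewrite coprimep_XsubC rootE horner_prod.
rewrite prodf_seq_neq0; apply/allP => b sb /=.
rewrite hornerE expf_neq0 // hornerXsubC subr_eq0.
by apply: contraNneq nas => ->.
Qed.

(** No eigenvalue has multiplicity above [n.+1], so such a [q] is a multiple of the characteristic
    polynomial. *)
Lemma horner_mx_eq0 (k : closedFieldType) n (X : 'M[k]_n.+1) :
  exists s : seq k, [/\ uniq s, forall a, (a \in s) = eigenvalue X a &
    forall q, (forall a, a \in s -> ('X - a%:P) ^+ n.+1 %| q) -> horner_mx X q = 0].
Proof.
have [s [sX ss sE _]] := trace_horner X.
exists (undup s); split=> [|a|q qs]; first exact: undup_uniq.
  rewrite mem_undup; apply/idP/idP => [/sE //|/eigenvalueP[u uX u0]].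
  have uq q : u *m horner_mx X q = q.[a] *: u.
    elim/poly_ind: q => [|q c IH]; first by rewrite rmorph0 mulmx0 horner0 scale0r.
    rewrite rmorphD rmorphM /= horner_mx_X horner_mx_C mulmxDr -mulmxE mulmxA IH.
    by rewrite -scalemxAl uX scalerA mul_mx_scalar -scalerDl hornerMXaddC.
  have := uq (\prod_(b <- s) ('X - b%:P)); rewrite sX mulmx0 => /esym/eqP.
  by rewrite scaler_eq0 (negbTE u0) orbF -rootE root_prod_XsubC.
have /dvdpP[c ->] : \prod_(b <- s) ('X - b%:P) %| q.
  apply: dvdp_trans (dvdp_prod_XsubC (undup_uniq s) qs).
  rewrite -big_undup_iterop_count; apply: (big_ind2 (fun x y => x %| y)) => //.
    by move=> *; apply: dvdp_mul.
  move=> b _; rewrite -[iterop _ _ _ _]/(('X - b%:P) ^+ count_mem b s).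
  by apply: dvdp_exp2l; rewrite -ss count_size.
by rewrite rmorphM /= sX mulr0.
Qed.

Section DerivativeOfRep.
Variables (k : closedFieldType) (G : algGroup k) (d : regf G -> k) (dP : pder d).
Variables (n : nat) (r : mrep G n.+1).
Implicit Types (u : 'rV[k]_n.+1) (v w : 'cV[k]_n.+1).

Lemma mcoefDr u v w : mcoef r u (v + w) = mcoef r u v + mcoef r u w.
Proof. by apply: regf_ext => x; rewrite regfD !mcoefE mulmxDr mxE. Qed.

Lemma mcoefZr u c v : mcoef r u (c *: v) = c *: mcoef r u v.
Proof. by apply: regf_ext => x; rewrite regfZ !mcoefE -scalemxAr mxE. Qed.

Lemma mcoefBr u v w : mcoef r u (v - w) = mcoef r u v - mcoef r u w.
Proof. by apply: regf_ext => x; rewrite regfB !mcoefE mulmxBr !mxE. Qed.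

Lemma mcoef0r u : mcoef r u 0 = 0.
Proof. by apply: regf_ext => x; rewrite mcoefE mulmx0 mxE. Qed.

Lemma mcoef_sumr u I (s : seq I) (P : pred I) (F : I -> 'cV[k]_n.+1) :
  mcoef r u (\sum_(i <- s | P i) F i) = \sum_(i <- s | P i) mcoef r u (F i).
Proof. by apply: (big_morph _ (mcoefDr u) (mcoef0r u)). Qed.

Lemma pder_mcoef u v : d (mcoef r u v) = (u *m dmx d r *m v) 0 0.
Proof.
rewrite /mcoef (pder_sum dP) mxE.
under eq_bigr do rewrite (pder_sum dP).
rewrite exchange_big /=; apply: eq_bigr => j _.
rewrite mxE mulr_suml; apply: eq_bigr => i _.
by rewrite (pderZ dP) mxE mulrAC.
Qed.

Lemma linv_mcoef u v : linv dP (mcoef r u v) = mcoef r u (dmx d r *m v).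
Proof.
apply: regf_ext => x; rewrite linvE.
have -> : ltr x (mcoef r u v) = mcoef r (u *m rho r x) v.
  by apply: regf_ext => y; rewrite /= !mcoefE rhoM !mulmxA.
by rewrite pder_mcoef mcoefE !mulmxA.
Qed.

Lemma rmat_mcoef i j : rmat r i j = mcoef r (delta_mx 0 i) (delta_mx j 0).
Proof.
by apply: regf_ext => x; rewrite mcoefE -rowE -colE !mxE.
Qed.
End DerivativeOfRep.

Section Replica.
Variables (k : closedFieldType) (G : algGroup k) (d : regf G -> k) (dP : pder d).
Local Notation regf := (regf G).
Variables (phi : k -> k) (phiD : forall x y, phi (x + y) = phi x + phi y).

Let D := linv dP.
Let E a (f : regf) : regf := D f - a *: f.

Let E0 a : E a 0 = 0.
Proof. by rewrite /E scaler0 /D raddf0 subr0. Qed.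
Let ED a f g : E a (f + g) = E a f + E a g.
Proof. by rewrite /E scalerDr /D raddfD opprD addrACA. Qed.
Let EZ a c f : E a (c *: f) = c *: E a f.
Proof. by rewrite /E /D linvZ scalerBr !scalerA mulrC. Qed.
Let EM a b f g : E (a + b) (f * g) = E a f * g + f * E b g.
Proof.
rewrite /E /D linvM mulrBl mulrBr scalerDl opprD addrACA -scalerAl.
by rewrite -[f * (b *: g)]mulrC -scalerAl (mulrC g).
Qed.

Let gen a f := exists N, iter N (E a) f = 0.

Let iterE0 N a : iter N (E a) 0 = 0.
Proof. by elim: N => //= N ->. Qed.
Let iterED N a f g : iter N (E a) (f + g) = iter N (E a) f + iter N (E a) g.
Proof. by elim: N => //= N ->. Qed.
Let iterEZ N a c f : iter N (E a) (c *: f) = c *: iter N (E a) f.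
Proof. by elim: N => //= N ->. Qed.

Let genZ a c f : gen a f -> gen a (c *: f).
Proof. by move=> [N NP]; exists N; rewrite iterEZ NP scaler0. Qed.

Let genM a b f g : gen a f -> gen b g -> gen (a + b) (f * g).
Proof.
move=> [N NP] [M MP]; exists (N + M)%N.
elim: N f g M NP MP => [|N IHN] f g M.
  by move=> /= -> _; rewrite mul0r iterE0.
elim: M f g => [|M IHM] f g fN gM.
  by move: gM => /= ->; rewrite mulr0 iterE0.
rewrite addnS iterSr EM iterED [X in _ + X](IHM f (E b g)) -?iterSr // addr0.
by rewrite addSnnS (IHN (E a f) g M.+1) // -iterSr.
Qed.

(** The graph of the replica: [f] is written as a sum of generalized eigenvectors of [D], and [c] is
    the value at 1 after scaling the component for [a] by [phi a]. *)
Let dec f c := exists2 l : seq (k * regf), forall t, t \in l -> gen t.1 t.2 &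
  f = \sum_(t <- l) t.2 /\ c = \sum_(t <- l) phi t.1 * t.2 1%g.

Let dec_lin z f g a b : dec f a -> dec g b -> dec (z *: f + g) (z * a + b).
Proof.
move=> [l lg [-> ->]] [m mg [-> ->]].
exists ([seq (t.1, z *: t.2) | t <- l] ++ m).
  by move=> t; rewrite mem_cat => /orP[/mapP[q lq ->]|/mg //]; exact/genZ/(lg q).
rewrite !big_cat !big_map /= scaler_sumr mulr_sumr; split=> //.
by congr (_ + _); apply: eq_bigr => t _; rewrite mulrCA.
Qed.

(** A product of generalized eigenvectors for [a] and [b] is one for [a + b], so additivity of [phi]
    becomes the Leibniz rule. *)
Let dec_mul f g a b : dec f a -> dec g b -> dec (f * g) (f 1%g * b + a * g 1%g).
Proof.
move=> [l lg [-> ->]] [m mg [-> ->]].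
exists [seq (t.1 + q.1, t.2 * q.2) | t <- l, q <- m].
  by move=> _ /allpairsP[[t q] /= [lt mq ->]]; apply: genM; [apply: lg|apply: mg].
rewrite !big_allpairs_dep /= !regf_sum mulr_suml; split.
  by apply: eq_bigr => t _; rewrite mulr_sumr.
rewrite !mulr_suml -big_split /=; apply: eq_bigr => t _.
rewrite !mulr_sumr -big_split /=; apply: eq_bigr => q _.
by rewrite phiD [X in _ = _ * X](_ : _ = t.2 1%g * q.2 1%g) //; ring.
Qed.

Let E_mcoef n (r : mrep G n.+1) N a u v : iter N (E a) (mcoef r u v) =
  mcoef r u (horner_mx (dmx d r) (('X - a%:P) ^+ N) *m v).
Proof.
elim: N => [|N IH]; first by rewrite expr0 rmorph1 mul1mx.
rewrite iterS IH /E /D linv_mcoef -mcoefZr.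
rewrite -mcoefBr exprS rmorphM rmorphB /= horner_mx_X horner_mx_C.
by rewrite -mulmxA mulmxBl mul_scalar_mx.
Qed.

(** Independence of generalized eigenspaces: inside one representation, a polynomial in its matrix
    scales every component by [phi] of its eigenvalue, and applied to a zero sum it gives 0. *)
Let dec_uniq c : dec 0 c -> c = 0.
Proof.
move=> [l lg [l0 ->]].
pose F (i : 'I_(size l).+1) : regf :=
  if unlift ord0 i is Some j then (tnth (in_tuple l) j).2 else 1.
have [|n [r [u [g [ug FE]]]]] := @matrix_coefs _ _ _ F ord0.
  by rewrite /F unlift_none.
pose X := dmx d r.
(* The translates of [u] by the [g i] are the standard basis rows, so a coefficient with row [u]
   determines its column. *)
have uinj v : mcoef r u v = 0 -> v = 0.
  move=> uv; apply/colP => i; have := congr1 (fun f : regf => f (g i)) uv.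
  by rewrite /= mcoefE ug -rowE !mxE.
pose v j : 'cV[k]_n.+1 := \col_i F (lift ord0 j) (g i).
pose t j := tnth (in_tuple l) j.
have tE j : (t j).2 = mcoef r u (v j).
  by apply: regf_ext => x; rewrite mcoefE -FE /F liftK.
have /choice[N NP] j : gen (t j).1 (t j).2 by apply/lg/mem_tnth.
pose M := \max_j N j.
have vM j : horner_mx X (('X - (t j).1%:P) ^+ M) *m v j = 0.
  apply: uinj; rewrite -E_mcoef -tE.
  have /subnK <- : (N j <= M)%N by apply: leq_bigmax.
  by rewrite iterD NP iterE0.
have [p pP] := poly_crt phi M [seq x.1 | x <- l].
have pv j : horner_mx X p *m v j = phi (t j).1 *: v j.
  have /dvdpP[q qE] := pP _ (map_f fst (mem_tnth j (in_tuple l))).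
  have -> : p = q * ('X - (t j).1%:P) ^+ M + (phi (t j).1)%:P.
    by rewrite -qE subrK.
  rewrite rmorphD rmorphM /= horner_mx_C mulmxDl -mulmxA vM mulmx0 add0r.
  by rewrite mul_scalar_mx.
have v0 : \sum_j v j = 0.
  apply: uinj; rewrite mcoef_sumr [RHS]l0 [RHS]big_tnth.
  by apply: eq_bigr => j _; rewrite -tE.
have : mcoef r u (horner_mx X p *m (\sum_j v j)) 1%g = 0.
  by rewrite v0 mulmx0 mcoef0r.
rewrite mulmx_sumr mcoef_sumr regf_sum => H; rewrite -[RHS]H big_tnth.
by apply: eq_bigr => j _; rewrite pv mcoefZr regfZ -tE.
Qed.

(** The polynomials [e a], congruent to 1 at [a] and to 0 at the other eigenvalues, give the
    spectral projections, which split the column [v]. *)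
Let dec_mcoef n (r : mrep G n.+1) u v p :
  (forall a, eigenvalue (dmx d r) a -> ('X - a%:P) ^+ n.+1 %| p - (phi a)%:P) ->
  dec (mcoef r u v) ((u *m horner_mx (dmx d r) p *m v) 0 0).
Proof.
set X := dmx d r => pP; have [s [us sX s0]] := horner_mx_eq0 X.
have /choice[e eP] a : exists e : {poly k}, forall b, b \in s ->
    ('X - b%:P) ^+ n.+1 %| e - ((b == a)%:R)%:P by apply: poly_crt.
have sum_e (h : k -> k) q : (forall b, b \in s -> ('X - b%:P) ^+ n.+1 %| q - (h b)%:P) ->
    horner_mx X q = \sum_(a <- s) h a *: horner_mx X (e a).
  move=> qP; apply/eqP; rewrite -subr_eq0.
  have -> : \sum_(a <- s) h a *: horner_mx X (e a)
            = horner_mx X (\sum_(a <- s) h a *: e a).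
    by rewrite raddf_sum /=; apply: eq_bigr => a _; rewrite horner_mxZ.
  rewrite -raddfB /= s0 // => b sb.
  have -> : q - \sum_(a <- s) h a *: e a = (q - (h b)%:P)
      - \sum_(a <- s) h a *: (e a - ((b == a)%:R)%:P).
    under [X in _ = _ - X]eq_bigr do rewrite scalerBr.
    rewrite sumrB (bigD1_seq b) //= [X in _ - (_ - X)](bigD1_seq b) //= eqxx.
    rewrite [X in _ - (_ - (_ + X))]big1 => [|a /negbTE ab]; last first.
      by rewrite eq_sym ab scaler0.
    by rewrite addr0 alg_polyC; ring.
  apply: dvdp_sub; first exact: qP.
  apply: (big_ind (fun x => _ %| x)); [exact: dvdp0|exact: dvdp_add|move=> a _].
  by rewrite -mul_polyC dvdp_mull // eP.
exists [seq (a, mcoef r u (horner_mx X (e a) *m v)) | a <- s].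
  move=> _ /mapP[a sa ->] /=; exists n.+1; rewrite E_mcoef mulmxA -/X.
  rewrite mulmxE -rmorphM /= s0 ?mul0mx ?mcoef0r // => b sb.
  have [->|ba] := eqVneq b a; first by rewrite dvdp_mulr.
  by apply: dvdp_mull; have := eP a b sb; rewrite (negbTE ba) subr0.
rewrite !big_map /=; split.
  rewrite -mcoef_sumr -mulmx_suml; congr mcoef.
  have := sum_e (fun=> 1) 1; rewrite rmorph1.
  under eq_bigr do rewrite scale1r; move=> <-; first by rewrite rmorph1 -[X in X *m _]/(1%:M) mul1mx.
  by move=> b _; rewrite subrr dvdp0.
have -> : horner_mx X p = \sum_(a <- s) phi a *: horner_mx X (e a).
  by apply: sum_e => b; rewrite sX; apply: pP.
rewrite mulmx_sumr mulmx_suml summxE; apply: eq_bigr => a _.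
by rewrite mcoefE rho1 mulmx1 -scalemxAr -scalemxAl mxE !mulmxA.
Qed.

(* Chevalley's replica: [e] is the value at the identity of the derivation of k[G]
   acting by [phi a] on the generalized eigenspace of [linv dP] for [a]. *)
Lemma replica : exists2 e, pder e & forall n (r : mrep G n.+1) p,
  (forall a, eigenvalue (dmx d r) a -> ('X - a%:P) ^+ n.+1 %| p - (phi a)%:P) ->
  dmx e r = horner_mx (dmx d r) p.
Proof.
have /choice[e eP] f : exists c, dec f c.
  pose F (i : 'I_2) := if i == ord0 then 1 else f.
  have [//|n [r [u [g [_ FE]]]]] := @matrix_coefs _ _ _ F ord0.
  have -> : f = mcoef r u (\col_i F ord_max (g i)).
    by apply: regf_ext => x; rewrite mcoefE -FE.
  have [s [_ sE _]] := horner_mx_eq0 (dmx d r).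
  have [p pP] := poly_crt phi n.+1 s.
  by eexists; apply: (@dec_mcoef _ _ _ _ p) => a; rewrite -sE; apply: pP.
have eE f c : dec f c -> e f = c.
  move=> fc; apply/eqP; rewrite -subr_eq0; apply/eqP/dec_uniq.
  have := dec_lin (-1) fc (eP f).
  by rewrite scaleN1r addNr mulN1r addrC.
exists e.
  by split=> [c f g|f g]; apply: eE; [apply: dec_lin|apply: dec_mul].
move=> n r p pP; apply/matrixP => i j; rewrite mxE rmat_mcoef.
by rewrite (eE _ _ (dec_mcoef _ _ pP)) -rowE -colE !mxE.
Qed.
End Replica.

Lemma mx_entry (R : pzRingType) m n (A : 'M[R]_(m, n)) i j :
  A i j = (delta_mx 0 i *m A *m delta_mx j 0 : 'M_1) 0 0.
Proof. by rewrite -rowE -colE !mxE. Qed.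

(** * Points as algebra morphisms; conjugation and brackets *)

Section Points.
Variables (k : closedFieldType) (G : algGroup k).
Local Notation regf := (regf G).

Lemma regf_point (psi : regf -> k) : (forall c, psi (c *: 1) = c) ->
  (forall f g, psi (f + g) = psi f + psi g) ->
  (forall f g, psi (f * g) = psi f * psi g) -> exists x, forall f, psi f = f x.
Proof.
move=> pc pD pM.
(* The value 0 on functions that are not regular is arbitrary: [algebra_hom] constrains [phi] only
   on regular ones. *)
pose phi (f : G -> k) := if pselect (reg f) is left Rf then psi (mkregf Rf) else 0.
have phiE (f : regf) (h : G -> k) : h = f -> phi h = psi f.
  move=> ->; rewrite /phi; case: pselect => [Rf|[]]; last exact: regfP.
  by congr psi; apply: regf_ext.
have [|x xP] := reg_points (phi := phi); last first.
  by exists x => f; rewrite -xP ?(phiE f) //; apply: regfP.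
split=> [c|f g Rf Rg|f g Rf Rg].
- by rewrite (phiE (c *: 1)) ?pc //; apply/funext => x; rewrite regfZ regf1 mulr1.
- by rewrite (phiE (mkregf Rf + mkregf Rg)) // pD (phiE (mkregf Rf)) // (phiE (mkregf Rg)).
- by rewrite (phiE (mkregf Rf * mkregf Rg)) // pM (phiE (mkregf Rf)) // (phiE (mkregf Rg)).
Qed.

(** This is the function sending [x] to the value of [f] at [g x g^-1]; composing a point derivation
    with it is the adjoint action of [g]. *)
Definition conjf g (f : regf) : regf := ltr g (rtr g^-1%g f).

Lemma pder_conj d g : pder d -> pder (fun f => d (conjf g f)).
Proof.
move=> dP; split=> [c f h|f h].
  by rewrite -dP.1; congr d; apply: regf_ext.
have c1 f' : conjf g f' 1%g = f' 1%g by rewrite /= mulg1 mulgV.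
by rewrite -(c1 f) -(c1 h) -dP.2; congr d; apply: regf_ext.
Qed.

Lemma dmx_conj d g n (r : mrep G n.+1) : pder d ->
  dmx (fun f => d (conjf g f)) r = rho r g *m dmx d r *m rho r g^-1%g.
Proof.
move=> dP; apply/matrixP => i j; rewrite mxE rmat_mcoef.
have -> : conjf g (mcoef r (delta_mx 0 i) (delta_mx j 0))
    = mcoef r (delta_mx 0 i *m rho r g) (rho r g^-1%g *m delta_mx j 0).
  by apply: regf_ext => x; rewrite /= !mcoefE !rhoM !mulmxA.
by rewrite (pder_mcoef dP) [RHS]mx_entry !mulmxA.
Qed.

Lemma pder_lin (c : k) d e : pder d -> pder e -> pder (fun f : regf => c * d f + e f).
Proof.
move=> dP eP; split=> [z f g|f g]; rewrite ?dP.1 ?eP.1 ?dP.2 ?eP.2; ring.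
Qed.

Section OneDerivation.
Variables (d : regf -> k) (dP : pder d).

Lemma pder_const c : d (c *: 1) = 0.
Proof. by rewrite (pderZ dP) (pder1 dP) mulr0. Qed.

Lemma pder_mulmx m n p (A : 'M[regf]_(m, n)) (B : 'M[regf]_(n, p)) :
  map_mx d (A *m B) = map_mx (ev 1%g) A *m map_mx d B + map_mx d A *m map_mx (ev 1%g) B.
Proof.
apply/matrixP => i j; rewrite !mxE (pder_sum dP) -big_split /=.
by apply: eq_bigr => l _; rewrite dP.2 !mxE.
Qed.

(** Membership in [L] amounts to linear relations with constant coefficients among the entries of
    [W], and [d] preserves them. *)
Lemma pder_mem n (L : {vspace 'M[k]_n}) (W : 'M[regf]_n) :
  (forall g, map_mx (ev g) W \in L) -> map_mx d W \in L.
Proof.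
move=> WL; pose Phi : 'End('M[k]_n) := \1%VF - projv L.
have PhiV v : Phi v = v - projv L v by rewrite add_lfunE opp_lfunE id_lfunE.
have PhiE v : Phi v = \sum_i \sum_j v i j *: Phi (delta_mx i j).
  rewrite {1}[v]matrix_sum_delta linear_sum; apply: eq_bigr => i _.
  by rewrite linear_sum; apply: eq_bigr => j _; rewrite linearZ.
have PhiL v : v \in L -> Phi v = 0 by move=> Lv; rewrite PhiV projv_id ?subrr.
have : Phi (map_mx d W) = 0.
  apply/matrixP => a b; rewrite PhiE summxE [RHS]mxE.
  have : \sum_i \sum_j Phi (delta_mx i j) a b *: W i j = 0.
    apply: regf_ext => g; have := PhiL _ (WL g); rewrite PhiE => /matrixP/(_ a b).
    rewrite summxE [RHS]mxE => e; apply: etrans e; rewrite regf_sum.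
    apply: eq_bigr => i _; rewrite regf_sum summxE; apply: eq_bigr => j _.
    by rewrite [RHS]mxE [X in _ = X * _]mxE regfZ mulrC.
  move=> /(congr1 d); rewrite (pder0 dP) (pder_sum dP) => e; apply: etrans e.
  apply: eq_bigr => i _; rewrite (pder_sum dP) summxE; apply: eq_bigr => j _.
  by rewrite (pderZ dP) [LHS]mxE [X in X * _ = _]mxE mulrC.
by rewrite PhiV => /subr0_eq ->; apply: memv_proj.
Qed.

(** Differentiating [rho r g *m x *m rho r g^-1] at the identity gives the commutator. Stability
    under conjugation thus yields stability under brackets with no bracket of derivations to
    define. *)
Lemma bracket_mem n (r : mrep G n.+1) (L : {vspace 'M[k]_n.+1}) x :
  (forall g, rho r g *m x *m rho r g^-1%g \in L) ->
  dmx d r *m x - x *m dmx d r \in L.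
Proof.
move=> xL; pose A := rmat r; pose B : 'M[regf]_n.+1 := map_mx (@invf _ G) A.
pose K : 'M[regf]_n.+1 := map_mx (fun c => c *: 1) x.
have evB g : map_mx (ev g) B = rho r g^-1%g by apply/matrixP => i j; rewrite !mxE.
have evK g : map_mx (ev g) K = x.
  by apply/matrixP => i j; rewrite !mxE /ev regfZ mulr1.
have evM g (P Q : 'M[regf]_n.+1) :
    map_mx (ev g) (P *m Q) = map_mx (ev g) P *m map_mx (ev g) Q.
  exact: map_mxM.
have dK : map_mx d K = 0 by apply/matrixP => i j; rewrite !mxE pder_const.
have AB : A *m B = 1%:M.
  apply/matrixP => i j; apply: regf_ext => g.
  have := rhoVr r g; rewrite -evB -[rho r g]/(map_mx (ev g) A) -evM.
  move=> /matrixP/(_ i j); rewrite mxE /ev => ->.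
  by rewrite !mxE; case: (i == j); rewrite ?mulr1n ?mulr0n.
have dB : map_mx d B = - dmx d r.
  have := pder_mulmx A B; rewrite AB evB invg1 rmat1 rho1 mul1mx mulmx1.
  have -> : map_mx d (1%:M : 'M[regf]_n.+1) = 0 :> 'M[k]_n.+1.
    apply/matrixP => i j; rewrite !mxE; case: (i == j).
      by rewrite mulr1n (pder1 dP).
    by rewrite mulr0n (pder0 dP).
  by move=> /eqP; rewrite eq_sym addr_eq0 => /eqP.
have := @pder_mem n.+1 L (A *m K *m B).
rewrite !pder_mulmx dK dB !evM evB !evK invg1 rho1 mulmx0 add0r mulmx1.
rewrite -[map_mx (ev 1%g) A]/(rho r 1%g) rho1 mul1mx mulmxN addrC; apply=> g.
by rewrite !evM evB evK; apply: xL.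
Qed.
End OneDerivation.
End Points.

Lemma ann_nilp (k : fieldType) n (T : {vspace 'M[k]_n.+1}) (Y : 'M[k]_n.+1) :
  ann_full T -> (forall p v, ann T p.+1 v -> ann T p (v *m Y)) ->
  exists N, Y ^+ N = 0.
Proof.
move=> [P TP] hY; exists P.
have main p v : ann T p v -> v *m Y ^+ p = 0.
  elim: p v => [|p IH] v; first by move=> /= ->; rewrite mul0mx.
  by move=> /hY/IH; rewrite exprS mulmxA.
by apply/row_matrixP => i; rewrite row0 rowE; apply/main/TP.
Qed.

(** * The stabilizer of the trace of a faithful representation *)

Section UnipotentPart.
Variables (k : closedFieldType) (char0 : [pchar k] =i pred0).
Variables (G : algGroup k) (Gred : reductive G).
Variables (n : nat) (r : mrep G n.+1) (r_gen : generating r).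
Local Notation regf := (regf G).

Let chi (x : G) := \tr (rho r x).
Let U : set G := [set u | forall h, chi (u * h)%g = chi h].

Let chi_regf : regf := \sum_i rmat r i i.
Let chiE x : chi_regf x = chi x.
Proof. by rewrite regf_sum; apply: eq_bigr => i _; rewrite rhoE. Qed.

(** All powers of [u] have trace [n.+1], so a polynomial [q] in [rho r u] has trace [n.+1] times
    [q.[1]]; this is 0 for the positive powers of [X - 1]. *)
Let U_nilp u : U u -> (rho r u - 1) ^+ n.+1 = 0.
Proof.
move=> Uu; have trX j : \tr (rho r u ^+ j) = n.+1%:R.
  rewrite -rhoX -/(chi _); elim: j => [|j IH].
    by rewrite expg0 /chi rho1 mxtrace1.
  by rewrite expgS Uu.
have trq q : \tr (horner_mx (rho r u) q) = n.+1%:R * q.[1].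
  rewrite -[q in LHS]coefK poly_def !raddf_sum /= horner_coef mulr_sumr.
  apply: eq_bigr => i _.
  by rewrite horner_mxZ rmorphXn /= horner_mx_X mxtraceZ trX expr1n mulr1 mulrC.
apply: nilp_of_traces => // j.
have -> : (rho r u - 1) ^+ j.+1 = horner_mx (rho r u) (('X - 1%:P) ^+ j.+1).
  by rewrite rmorphXn rmorphB /= horner_mx_X horner_mx_C.
by rewrite trq horner_exp hornerXsubC subrr expr0n mulr0.
Qed.

Section Difference.
Variable u : G.
Let Delta (f : regf) : regf := rtr u f - f.

Let DE f x : Delta f x = f (x * u)%g - f x. Proof. by []. Qed.
Let DD f g : Delta (f + g) = Delta f + Delta g.
Proof. by apply: regf_ext => x; rewrite !(DE, regfD); ring. Qed.
Let D0 : Delta 0 = 0.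
Proof. by apply: regf_ext => x; rewrite DE subrr. Qed.
Let iD0 N : iter N Delta 0 = 0.
Proof. by elim: N => //= N ->. Qed.
Let iDD N f g : iter N Delta (f + g) = iter N Delta f + iter N Delta g.
Proof. by elim: N => //= N ->. Qed.
Let DM f g : Delta (f * g) = Delta f * Delta g + Delta f * g + f * Delta g.
Proof. by apply: regf_ext => x; rewrite !(DE, regfD, regfM); ring. Qed.

(** [Delta] is a derivation up to the term [Delta f * Delta g], which only helps since it lowers
    both exponents; a double induction then treats products. *)
Lemma difference_nilp : (rho r u - 1) ^+ n.+1 = 0 ->
  forall f, exists N, iter N Delta f = 0.
Proof.
move=> uN; apply: r_gen => [c|f g [N fN] [M gM]|f g [N fN] [M gM]|i j].
- by exists 1%N; apply: regf_ext => x; exact: subrr.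
- exists (N + M)%N; rewrite iDD {1}addnC !iterD fN gM; by rewrite !iD0 addr0.
- exists (N + M)%N; elim: N f g M fN gM => [|N IHN] f g M.
    by move=> /= -> _; rewrite mul0r iD0.
  elim: M f g => [|M IHM] f g fN gM.
    by move: gM => /= ->; rewrite mulr0 iD0.
  rewrite addnS iterSr DM !iDD.
  rewrite [X in _ + X](IHM f (Delta g)) -?iterSr // addr0.
  rewrite {2}addSnnS (IHN (Delta f) g M.+1) -?iterSr // addr0.
  by rewrite addSn iterS (IHN (Delta f) (Delta g) M) -?iterSr.
- exists n.+1; rewrite rmat_mcoef.
  have it N v : iter N Delta (mcoef r (delta_mx 0 i) v)
      = mcoef r (delta_mx 0 i) ((rho r u - 1) ^+ N *m v).
    elim: N => [|N IH]; first by rewrite expr0 -[1 *m v]/(1%:M *m v) mul1mx.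
    rewrite iterS IH; apply: regf_ext => x; rewrite DE !mcoefE rhoM.
    set w := _ ^+ N *m v.
    have -> : (rho r u - 1) ^+ N.+1 *m v = rho r u *m w - w.
      by rewrite exprS -[_ * _]/(_ *m _) -mulmxA mulmxBl mul1mx.
    by rewrite mulmxBr [RHS]mxE [X in _ = _ + X]mxE !mulmxA.
  by rewrite it uN mul0mx mcoef0r.
Qed.
End Difference.

(** The binomial expansion of [(1 + N) ^+ m] stops at [N ^+ n], and in characteristic 0 each
    binomial coefficient is a polynomial in [m]. *)
Lemma rtr_pow_poly u : (rho r u - 1) ^+ n.+1 = 0 ->
  forall f : regf, exists p : {poly k}, forall m, p.[m%:R] = f (u ^+ m)%g.
Proof.
move=> uN; set N := rho r u - 1 in uN.
apply: r_gen => [c|f g [p pf] [q qg]|f g [p pf] [q qg]|a b].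
- by exists c%:P => m; rewrite hornerC regfZ regf1 mulr1.
- by exists (p + q) => m; rewrite hornerD pf qg.
- by exists (p * q) => m; rewrite hornerM pf qg.
have /choice[bp bpE] i : exists p : {poly k}, forall m : nat, p.[m%:R] = 'C(m, i)%:R.
  exists ((i`!)%:R^-1 *: \prod_(j < i) ('X - j%:R%:P)) => m.
  have i0 : (i`!%:R : k) != 0 by rewrite natk_eq0 // -lt0n fact_gt0.
  rewrite hornerZ; apply: (canLR (mulKf i0)); rewrite -natrM mulnC bin_ffact.
  elim: i {i0} => [|i IH]; first by rewrite big_ord0 hornerE ffactn0.
  rewrite big_ord_recr /= hornerM IH ffactnSr hornerXsubC natrM.
  have [im|mi] := leqP i m; first by rewrite natrB.
  by rewrite ffact_small // !mul0r.
exists (\sum_(i < n.+1) (N ^+ i) a b *: bp i) => m.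
rewrite -rhoE rhoX.
have -> : rho r u = 1 + N by rewrite /N addrC subrK.
transitivity ((\sum_(i < n.+1) N ^+ i *+ 'C(m, i)) a b).
  rewrite horner_sum summxE; apply: eq_bigr => i _.
  by rewrite hornerZ bpE mulmxnE mulr_natr.
congr (fun_of_matrix _ a b).
elim: m => [|m IH].
  by rewrite big_ord_recl big1 ?addr0 ?expr0 ?bin0 ?mulr1n.
have SN : (\sum_(i < n.+1) N ^+ i *+ 'C(m, i)) * N = \sum_(i < n) N ^+ i.+1 *+ 'C(m, i).
  rewrite mulr_suml big_ord_recr /= mulrnAl -exprSr uN mul0rn addr0.
  by apply: eq_bigr => i _; rewrite mulrnAl -exprSr.
rewrite exprSr -IH mulrDr mulr1 SN big_ord_recl [X in _ = X + _]big_ord_recl !bin0.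
rewrite -addrA -big_split /=; congr (_ + _); apply: eq_bigr => i _.
by rewrite binS mulrnDr.
Qed.

Let U_closed : closed_subgroup U.
Proof.
split; first split.
- by move=> h; rewrite mul1g.
- by move=> x y Ux Uy h; rewrite -mulgA Ux Uy.
- by move=> x Ux h; rewrite -[in LHS](Ux (x^-1 * h)%g) mulVKg.
exists [set f : G -> k | exists h, f = (rtr h chi_regf - (chi h) *: 1 : regf)]%classic.
  by move=> f [h ->]; apply: regfP.
apply/seteqP; split=> [x Ux f [h ->]|x Ux h].
  by rewrite regfB regfZ mulr1 /= chiE Ux subrr.
apply/eqP; rewrite -subr_eq0; apply/eqP.
have := Ux _ (ex_intro _ h erefl).
by rewrite regfB regfZ mulr1 /= chiE.
Qed.

Let U_normal : normal_subset U.
Proof.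
have chiC x y : chi (x * y)%g = chi (y * x)%g by rewrite /chi !rhoM mxtrace_mulC.
by move=> g x Ux h; rewrite -!mulgA chiC -!mulgA Ux !mulgA chiC !mulgA mulgV mul1g.
Qed.

Let U_unipotent : unipotent U.
Proof.
move=> u /U_nilp uN f Rf; have [N NP] := difference_nilp uN (mkregf Rf).
exists N => x; transitivity (iter N (fun f : regf => rtr u f - f) (mkregf Rf) x).
  elim: N x {NP} => [|N IH] x //; by rewrite !iterS IH IH.
by rewrite NP.
Qed.

Let U_connected : zconnected U.
Proof.
have sgU : subgroup U by case: U_closed.
(* If [u] were outside [B], some [f] zero on [B] and some [g] zero on [C] would satisfy [f u <> 0]
   and [g 1 <> 0]. Along the powers of [u] their product vanishes, so one of the two polynomials is
   0, contradicting its value at 1 or at 0. *)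
have claim B C u : zclosed B -> zclosed C -> (U `<=` B `|` C)%classic ->
    (U `&` B `&` C = set0)%classic -> B 1%g -> U u -> B u.
  move=> [SB RB EB] [SC RC EC] UBC U0 B1 Uu; apply: contrapT => nBu.
  have [U1 UM _] := sgU.
  have UX m : U (u ^+ m)%g.
    by elim: m => [|m IH]; rewrite ?expg0 // expgS; apply: UM.
  have nC1 : ~ C 1%g by move=> C1; have : (set0 : set G) 1%g by rewrite -U0.
  have [f [Sf fu]] : exists f, SB f /\ f u <> 0.
    apply: contrapT => nf; apply: nBu; rewrite EB => f Sf.
    by apply: contrapT => fu; apply: nf; exists f.
  have [g [Sg g1]] : exists g, SC g /\ g 1%g <> 0.
    apply: contrapT => ng; apply: nC1; rewrite EC => g Sg.
    by apply: contrapT => g1; apply: ng; exists g.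
  have [p pf] := rtr_pow_poly (U_nilp Uu) (mkregf (RB _ Sf)).
  have [q qg] := rtr_pow_poly (U_nilp Uu) (mkregf (RC _ Sg)).
  have /eqP : p * q = 0.
    apply: (poly_nat_eq0 char0) => m; rewrite hornerM pf qg /=.
    have := UBC _ (UX m); rewrite EB EC => -[/(_ _ Sf) ->|/(_ _ Sg) ->].
      by rewrite mul0r.
    by rewrite mulr0.
  rewrite mulf_eq0 => /orP[] /eqP e0.
    by apply: fu; have := pf 1%N; rewrite e0 horner0 expg1.
  by apply: g1; have := qg 0%N; rewrite e0 horner0 expg0.
move=> B C cB cC UBC U0; have [U1 _ _] := sgU.
have [B1|C1] := UBC _ U1.
  right; rewrite -subset0 => x [Ux Cx]; rewrite -U0; split=> //; split=> //.
  exact: (claim B C x).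
left; rewrite -subset0 => x [Ux Bx]; rewrite -U0; split; first by split.
apply: (claim C B x) => //; first by rewrite setUC.
by rewrite -setIA (setIC C) setIA.
Qed.

(* The stabilizer of the trace lies in the unipotent radical; it is connected because
   the functions [m |-> f (u ^+ m)] are polynomial. *)
Lemma trace_stabilizer_trivial u : (forall h, \tr (rho r (u * h)%g) = \tr (rho r h)) ->
  u = 1%g.
Proof.
move=> Uu; suff : @unipotent_radical k G u by rewrite Gred.
by exists U.
Qed.
End UnipotentPart.

(** * Exponentials of locally nilpotent derivations *)

Section Exponential.
Variables (k : closedFieldType) (char0 : [pchar k] =i pred0) (G : algGroup k).
Local Notation regf := (regf G).
Variables (d : regf -> k) (dP : pder d).
Let D := linv dP.

Let D0 N : iter N D 0 = 0.
Proof. by elim: N => //= N ->; rewrite /D raddf0. Qed.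
Let DD N f g : iter N D (f + g) = iter N D f + iter N D g.
Proof. by elim: N => //= N ->; rewrite /D raddfD. Qed.

Lemma linv_locally_nilp n (r : mrep G n.+1) N : generating r -> dmx d r ^+ N = 0 ->
  forall f, exists m, iter m D f = 0.
Proof.
move=> r_gen XN; apply: r_gen => [c|f g [m fm] [l gl]|f g [m fm] [l gl]|i j].
- by exists 1%N; rewrite /= /D linv_const.
- by exists (m + l)%N; rewrite DD {1}addnC !iterD fm gl !D0 addr0.
- exists (m + l)%N; elim: m f g l fm gl => [|m IHm] f g l.
    by move=> /= -> _; rewrite mul0r D0.
  elim: l f g => [|l IHl] f g fm gl.
    by have -> : g = 0 by []; rewrite mulr0 D0.
  rewrite addnS iterSr /D linvM -/D DD [X in _ + X](IHl f (D g)) -?iterSr // addr0.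
  by rewrite addSnnS (IHm (D f) g l.+1) // -iterSr.
- exists N; rewrite rmat_mcoef.
  have it m v : iter m D (mcoef r (delta_mx 0 i) v)
      = mcoef r (delta_mx 0 i) (dmx d r ^+ m *m v).
    elim: m => [|m IH]; first by rewrite expr0 mul1mx.
    by rewrite iterS IH /D linv_mcoef mulmxA mulmxE -exprS.
  by rewrite it XN mul0mx mcoef0r.
Qed.

Hypothesis D_nilp : forall f, exists m, iter m D f = 0.

(** [p] is the expansion in t of the value of [f] at the exponential of t times [d], with factorials
    kept on the left to avoid division. *)
Let taylor f (p : {poly k}) := forall n, p`_n *+ n`! = iter n D f 1%g.

Let fact_neq0 n : (n`!%:R : k) != 0.
Proof. by rewrite natk_eq0 // -lt0n fact_gt0. Qed.

Let taylor_ex f : exists p, taylor f p.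
Proof.
have [m fm] := D_nilp f.
exists (\poly_(i < m) ((i`!%:R)^-1 * iter i D f 1%g)) => n.
rewrite coef_poly; case: ltnP => [_|mn].
  by rewrite -[LHS]mulr_natl mulVKf ?fact_neq0.
by rewrite mul0rn -(subnK mn) iterD fm D0.
Qed.

Let taylor_uniq f p q : taylor f p -> taylor f q -> p = q.
Proof.
move=> fp fq; apply/polyP => n; apply: (mulIf (fact_neq0 n)).
by rewrite !mulr_natr fp fq.
Qed.

Let taylor_deriv f p : taylor f p -> taylor (D f) p^`().
Proof. by move=> fp n; rewrite coef_deriv -mulrnA fp iterSr. Qed.

Let taylorM f g p q : taylor f p -> taylor g q -> taylor (f * g) (p * q).
Proof.
move=> fp gq n; elim: n f g p q fp gq => [|n IH] f g p q fp gq.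
  by rewrite coef0M; have := fp 0%N; have := gq 0%N; rewrite !mulr1n => -> ->.
rewrite factS mulrnA -coef_deriv derivM coefD mulrnDl iterSr /D linvM -/D DD.
by rewrite regfD (IH (D f) g p^`() q) ?(IH f (D g) p q^`()) //; apply: taylor_deriv.
Qed.

(** The product rule makes Taylor expansion at 1 an algebra morphism from k[G] to polynomials;
    followed by evaluation at [t] it is a point of G. *)
Lemma one_parameter_subgroup : exists2 p : regf -> {poly k},
  forall f n, (p f)`_n *+ n`! = iter n D f 1%g &
  forall t, exists x, forall f, (p f).[t] = f x.
Proof.
have /choice[p pP] := taylor_ex.
exists p => // t; apply: regf_point => [c|f g|f g].
- rewrite (@taylor_uniq (c *: 1) _ c%:P (pP _)) ?hornerC // => -[|n].
    by rewrite coefC eqxx mulr1n /= mulr1.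
  by rewrite coefC mul0rn iterSr /D linv_const -/D D0.
- rewrite (@taylor_uniq (f + g) _ (p f + p g) (pP _)) ?hornerD // => n.
  by rewrite coefD mulrnDl !pP DD.
- by rewrite (@taylor_uniq (f * g) _ (p f * p g) (pP _)) ?hornerM //; apply: taylorM.
Qed.
End Exponential.

(** * Vanishing of ideals of nilpotent derivations *)

Section NilpotentIdeal.
Variables (k : closedFieldType) (char0 : [pchar k] =i pred0).
Variables (G : algGroup k) (Gred : reductive G).
Variables (n : nat) (r : mrep G n.+1) (r_gen : generating r).
Local Notation regf := (regf G).

Lemma iter_mulmx (X : 'M[k]_n.+1) m : iter m (mulmx X) 1%:M = X ^+ m.
Proof. by elim: m => //= m ->; rewrite exprS. Qed.

(* The exponentials of a nilpotent ideal fix the trace of a faithful representation. *)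
Lemma nilpotent_ideal_trivial (a : (regf -> k) -> Prop) :
  (forall d, a d -> pder d) ->
  (forall c d e, a d -> a e -> a (fun f => c * d f + e f)) ->
  (forall g d, a d -> a (fun f => d (conjf g f))) ->
  (forall d, a d -> exists N, dmx d r ^+ N = 0) ->
  forall d, a d -> forall f, d f = 0.
Proof.
move=> aP aD aJ aN d ad.
have dmxD c d1 d2 : dmx (fun f : regf => c * d1 f + d2 f) r = c *: dmx d1 r + dmx d2 r.
  by apply/matrixP => i j; rewrite !mxE.
have [||L LP] :=
    @vspace_of_set _ _ (fun X : 'M[k]_n.+1 => exists2 e, a e & X = dmx e r).
- exists (fun f => -1 * d f + d f); first exact: aD.
  by rewrite dmxD scaleN1r addNr.
- move=> c u v [d1 a1 ->] [d2 a2 ->].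
  by exists (fun f => c * d1 f + d2 f); rewrite ?dmxD //; apply: aD.
have LJ g x : x \in L -> rho r g *m x *m rho r g^-1%g \in L.
  move=> /LP[e ae ->]; apply/LP; exists (fun f => e (conjf g f)); first exact: aJ.
  by rewrite dmx_conj //; apply: aP.
have Lfull : ann_full L.
  apply: engel => [y x /LP[e ae ->] Lx|x /LP[e /aN[N eN] ->]].
    by apply: (bracket_mem (aP e ae)) => g; apply: LJ.
  by exists N => v; rewrite iter_mulmx eN mulmx0.
have dP := aP d ad; pose X := dmx d r.
have LX : X \in L by apply/LP; exists d.
have [N XN] := aN d ad.
have [p pE px] := one_parameter_subgroup char0 (linv_locally_nilp dP r_gen XN).
have rho_ann g q v : ann L q v -> ann L q (v *m rho r g).
  apply: ann_stable => t Lt; exists (rho r g *m t *m rho r g^-1%g); first exact: LJ.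
  by rewrite -(mulmxA _ (rho r g^-1%g)) rhoVl mulmx1.
have X_ann m q v : ann L q v -> ann L q (v *m X ^+ m).
  elim: m v => [|m IH] v qv; first by rewrite expr0 mulmx1.
  rewrite exprS -mulmxE mulmxA; apply: IH; case: q qv => [|q] qv.
    by move: qv => /= ->; rewrite mul0mx.
  exact/annS/qv.
(* [X] lowers the series of [L] by a step and [rho r h] preserves each of its levels, so the product
   is nilpotent. *)
have trX m h : \tr (X ^+ m.+1 *m rho r h) = 0.
  have [|M YM] := @ann_nilp _ _ L (X ^+ m.+1 *m rho r h) Lfull.
    move=> q v qv; rewrite mulmxA; apply: rho_ann; rewrite exprS -mulmxE mulmxA.
    by apply: X_ann; apply: qv.
  exact: trace_nilp YM.
(* [F h] sends [x] to the trace of [rho r (x * h)]. By [trX] its Taylor expansion is constant, so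
   the exponentials fix the trace. *)
pose F h : regf := \sum_i mcoef r (delta_mx 0 i) (rho r h *m delta_mx i 0).
have FE h m : iter m (linv dP) (F h)
    = \sum_i mcoef r (delta_mx 0 i) (X ^+ m *m rho r h *m delta_mx i 0).
  elim: m => [|m IH].
    by rewrite expr0; apply: eq_bigr => i _; rewrite mul1mx.
  rewrite iterS IH raddf_sum; apply: eq_bigr => i _.
  by rewrite /= linv_mcoef !mulmxA mulmxE -exprS.
have Fx h m x : iter m (linv dP) (F h) x = \tr (rho r x *m X ^+ m *m rho r h).
  rewrite FE regf_sum; apply: eq_bigr => i _.
  by rewrite mcoefE [RHS]mx_entry !mulmxA.
have pF h t : (p (F h)).[t] = \tr (rho r h).
  have -> : p (F h) = (\tr (rho r h))%:P.
    apply/polyP => -[|m]; have := pE (F h) _; rewrite coefC /=.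
      by move=> /(_ 0%N); rewrite mulr1n Fx rho1 mul1mx mul1mx.
    move=> /(_ m.+1); rewrite Fx rho1 mul1mx trX => /eqP.
    have /negbTE fm : (m.+1`!%:R : k) != 0 by rewrite natk_eq0 // -lt0n fact_gt0.
    by rewrite -mulr_natr mulf_eq0 fm orbF => /eqP.
  by rewrite hornerC.
(* The exponentials are therefore all equal to 1. The expansion of every [f] is then constant, and
   its linear coefficient [d f] is 0. *)
have p1 f t : (p f).[t] = f 1%g.
  have [x xP] := px t; rewrite xP; congr (f _).
  apply: (trace_stabilizer_trivial char0 Gred r_gen) => h.
  have <- : F h x = \tr (rho r (x * h)%g) by rewrite rhoM (Fx h 0%N) mulmx1.
  by rewrite -xP pF.
move=> f; have : p f - (f 1%g)%:P = 0.
  by apply: (poly_nat_eq0 char0) => m; rewrite hornerD hornerN hornerC p1 subrr.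
move=> /subr0_eq pf; have := pE f 1%N.
by rewrite pf coefC mul0rn -(linv1 dP f) => ->.
Qed.
End NilpotentIdeal.

(** * Nondegeneracy of the trace form and the equivariant Casimir operator *)

Section TraceFormOfRep.
Variables (k : closedFieldType) (char0 : [pchar k] =i pred0).
Variables (G : algGroup k) (Gred : reductive G).
Local Notation regf := (regf G).

Lemma dmx_lin n (r : mrep G n) c (d e : regf -> k) :
  dmx (fun f => c * d f + e f) r = c *: dmx d r + dmx e r.
Proof. by apply/matrixP => i j; rewrite !mxE. Qed.

(** One [e] serves all representations simultaneously, which is what links E and V; [phi 0 = 0]
    makes [e] vanish wherever [d] is nilpotent. *)
Definition is_replica (d e : regf -> k) := exists2 phi : k -> k, phi 0 = 0 &
  pder e /\ forall n (r : mrep G n.+1) p,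
    (forall a, eigenvalue (dmx d r) a -> ('X - a%:P) ^+ n.+1 %| p - (phi a)%:P) ->
    dmx e r = horner_mx (dmx d r) p.

Lemma replica_nilp d e n (r : mrep G n.+1) N : is_replica d e ->
  dmx d r ^+ N = 0 -> dmx e r = 0.
Proof.
move=> [phi phi0 [_ eP]] dN; rewrite (eP _ _ 0) ?rmorph0 // => a.
by move=> /(eigenvalue_nilp dN) ->; rewrite phi0 subrr dvdp0.
Qed.

Lemma nilp_of_orthogonal_replicas d n (r : mrep G n.+1) : pder d ->
  (forall e, is_replica d e -> \tr (dmx d r *m dmx e r) = 0) ->
  dmx d r ^+ n.+1 = 0.
Proof.
move=> dP de; apply: (nilp_of_replicas char0) => phi phiD phiZ.
have rD x y : ratr (phi (x + y)) = ratr (phi x) + ratr (phi y) :> k.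
  by rewrite phiD ratr_addk.
have [e eP er] := replica dP rD.
have [s [_ sE _]] := horner_mx_eq0 (dmx d r).
have [p pP] := poly_crt (fun a => ratr (phi a) : k) n.+1 s.
have {}pP a : eigenvalue (dmx d r) a -> ('X - a%:P) ^+ n.+1 %| p - (ratr (phi a))%:P.
  by rewrite -sE; apply: pP.
exists p => [a /pP /dvdpP[q qE]|].
  have -> : p = q * ('X - a%:P) ^+ n.+1 + (ratr (phi a))%:P by rewrite -qE subrK.
  by rewrite hornerD hornerM horner_exp hornerXsubC subrr expr0n mulr0 add0r hornerC.
rewrite -(er _ _ _ pP); apply: de; exists (fun x => ratr (phi x)) => //.
by have := rD 0 0; rewrite addr0 => e0; apply: (addrI (ratr (phi 0))); rewrite -e0 addr0.
Qed.

Lemma trace_conj n (g h x y : 'M[k]_n) :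
  \tr (g *m x *m h *m y) = \tr (x *m (h *m y *m g)).
Proof. by rewrite -!mulmxA mxtrace_mulC !mulmxA. Qed.

Variables (m : nat) (E : mrep G m.+1).

Let trivialE (d : regf -> k) := pder d /\ dmx d E = 0.

Let trivialE_lin c d e : trivialE d -> trivialE e -> trivialE (fun f => c * d f + e f).
Proof.
move=> [dP dE] [eP eE]; split; first exact: pder_lin.
by rewrite dmx_lin dE eE scaler0 addr0.
Qed.

Let trivialE_conj g d : trivialE d -> trivialE (fun f => d (conjf g f)).
Proof.
move=> [dP dE]; split; first exact: pder_conj.
by rewrite dmx_conj // dE mulmx0 mul0mx.
Qed.

Lemma pder_zero : pder (fun _ : regf => 0).
Proof. by split=> *; rewrite ?mulr0 ?mul0r addr0. Qed.

(* The kernel n of g -> gl(E) carries a nondegenerate trace form in a faithful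
   representation V. After projection to the orthogonal of n, an element x of the radical
   of the trace form of E is nilpotent on E, so its replicas lie in n and are orthogonal
   to x in V; hence x is nilpotent on V as well. *)
Lemma trace_form_nondeg d0 : pder d0 ->
  (forall e, pder e -> \tr (dmx d0 E *m dmx e E) = 0) -> dmx d0 E = 0.
Proof.
have [n [r r_gen]] := exists_faithful G.
pose nil := nilpotent_ideal_trivial char0 Gred r_gen.
have [||L LP] := @vspace_of_set _ _
    (fun X : 'M[k]_n.+1 => exists2 e, trivialE e & X = dmx e r).
- exists (fun=> 0); first by split; [exact: pder_zero|apply/matrixP => i j; rewrite !mxE].
  by apply/matrixP => i j; rewrite !mxE.
- move=> c u v [d1 a1 ->] [d2 a2 ->].
  by exists (fun f => c * d1 f + d2 f); rewrite ?dmx_lin //; apply: trivialE_lin.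
have conj_tr d' e g : pder d' -> pder e ->
    \tr (dmx (fun f => d' (conjf g f)) r *m dmx e r)
    = \tr (dmx d' r *m dmx (fun f => e (conjf g^-1%g f)) r).
  by move=> dP eP; rewrite !dmx_conj // invgK trace_conj.
have Lnd x : x \in L -> (forall y, y \in L -> \tr (x *m y) = 0) -> x = 0.
  move=> /LP[d [dP dE] ->] dL.
  (* The radical of the trace form of V on the kernel of E. Replicas of its elements also act by 0
     on E, so they stay in that kernel and are orthogonal to it. *)
  pose a d := trivialE d /\ forall e, trivialE e -> \tr (dmx d r *m dmx e r) = 0.
  have d00 : forall f, d f = 0.
    apply: (nil a) => [? [[]] //|c d1 d2 [t1 a1] [t2 a2]|g d1 [t1 a1]|d1 [[P1 E1] a1]|].
    - split=> [|e te]; first exact: trivialE_lin.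
      by rewrite dmx_lin mulmxDl raddfD -scalemxAl /= mxtraceZ a1 // a2 // mulr0 addr0.
    - split=> [|e te]; first exact: trivialE_conj.
      by rewrite conj_tr ?a1 //; [apply: trivialE_conj|case: t1|case: te].
    - exists n.+1; apply: nilp_of_orthogonal_replicas => // e de; apply: a1.
      split; first by case: de => ? _ [].
      by apply: (replica_nilp (N := 1) de); rewrite expr1.
    - by split=> // e te; apply: dL; apply/LP; exists e.
  by apply/matrixP => i j; rewrite !mxE d00.
move=> dP dE.
have [z /LP[z' [z'P z'E] ->] zL] := trace_projection Lnd (dmx d0 r).
pose b d := [/\ pder d, forall e, pder e -> \tr (dmx d E *m dmx e E) = 0
  & forall e, trivialE e -> \tr (dmx d r *m dmx e r) = 0].
(* Subtracting the projection [z'] leaves the action on E unchanged and makes the result orthogonal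
   to [L] in V, so that it satisfies [b]. *)
pose d' f := -1 * z' f + d0 f.
have d'E : dmx d' E = dmx d0 E by rewrite dmx_lin z'E scaler0 add0r.
have d'0 : forall f, d' f = 0.
  apply: (nil b) => [x [] //|c d1 d2 [P1 e1 r1] [P2 e2 r2]|g d1 [P1 e1 r1]|d1 [P1 e1 r1]|].
  - split=> [|e eP|e te]; first exact: pder_lin.
      by rewrite dmx_lin mulmxDl raddfD -scalemxAl /= mxtraceZ e1 // e2 // mulr0 addr0.
    by rewrite dmx_lin mulmxDl raddfD -scalemxAl /= mxtraceZ r1 // r2 // mulr0 addr0.
  - split=> [|e eP|e te]; first exact: pder_conj.
      have -> : \tr (dmx (fun f => d1 (conjf g f)) E *m dmx e E)
          = \tr (dmx d1 E *m dmx (fun f => e (conjf g^-1%g f)) E).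
        by rewrite !dmx_conj // invgK trace_conj.
      by apply: e1; apply: pder_conj.
    by rewrite conj_tr ?r1 //; [apply: trivialE_conj|case: te].
  - have d1E : dmx d1 E ^+ m.+1 = 0.
      by apply: nilp_of_orthogonal_replicas => // e [? _ [eP _]]; apply: e1.
    exists n.+1; apply: nilp_of_orthogonal_replicas => // e de; apply: r1.
    split; first by case: de => ? _ [].
    exact: replica_nilp de d1E.
  - split=> [|e eP|e te]; first exact: pder_lin.
      by rewrite d'E dE.
    rewrite dmx_lin scaleN1r addrC; apply: zL; apply/LP; by exists e.
by rewrite -d'E; apply/matrixP => i j; rewrite !mxE d'0.
Qed.

(** The trace of [C] is the dimension of the image of the Lie algebra in gl(E), a positive integer
    and so nonzero in k. *)
Lemma equivariant_casimir : (exists2 d, pder d & dmx d E <> 0) ->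
  exists C : 'M[k]_m.+1, [/\ \tr C != 0,
    forall w : 'cV_m.+1, (forall d, pder d -> dmx d E *m w = 0) -> C *m w = 0
    & forall g, rho E g *m C = C *m rho E g].
Proof.
move=> [d0 d0P d0E].
have [||L LP] := @vspace_of_set _ _
    (fun X : 'M[k]_m.+1 => exists2 e, pder e & X = dmx e E).
- exists (fun=> 0); first exact: pder_zero.
  by apply/matrixP => i j; rewrite !mxE.
- move=> c u v [d1 a1 ->] [d2 a2 ->].
  by exists (fun f => c * d1 f + d2 f); rewrite ?dmx_lin //; apply: pder_lin.
have [|C [Cw trC CJ]] := @casimir _ _ L.
  move=> _ /LP[d dP ->] dL; apply: trace_form_nondeg => // e eP.
  by apply: dL; apply/LP; exists e.
exists C; split=> [|w dw|g].
- rewrite trC natk_eq0 // dimv_eq0; apply: contra_notN d0E => /eqP L0.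
  by apply/eqP; rewrite -memv0 -L0; apply/LP; exists d0.
- by apply: Cw => _ /LP[d dP ->]; apply: dw.
- apply: CJ (rhoVr E g) _ => _ /LP[d dP ->].
  by apply/LP; exists (fun f => d (conjf g f)); rewrite ?dmx_conj //; apply: pder_conj.
Qed.
End TraceFormOfRep.

(** * Noetherian rings and Hilbert's basis theorem *)

Section NoetherianRings.
Implicit Type R : comNzRingType.

Definition spanned R (q : nat -> R) N x := exists c : nat -> R, x = \sum_(i < N) c i * q i.

Lemma spanned_lin R (q : nat -> R) N z x y :
  spanned q N x -> spanned q N y -> spanned q N (z * x + y).
Proof.
move=> [c ->] [e ->]; exists (fun i => z * c i + e i).
by rewrite mulr_sumr -big_split; apply: eq_bigr => i _ /=; ring.
Qed.

Lemma spanned0 R (q : nat -> R) N : spanned q N 0.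
Proof. by exists (fun=> 0); rewrite big1 // => i _; rewrite mul0r. Qed.

Lemma spanned_mem R (q : nat -> R) N i : (i < N)%N -> spanned q N (q i).
Proof.
move=> iN; exists (fun j => (j == i)%:R).
rewrite (bigD1 (Ordinal iN)) //= eqxx mul1r big1 ?addr0 // => j.
by rewrite -val_eqE /= => /negbTE ->; rewrite mul0r.
Qed.

Lemma spanned_sum R (q : nat -> R) N (f c : nat -> R) M :
  (forall i, (i < M)%N -> spanned q N (f i)) -> spanned q N (\sum_(i < M) c i * f i).
Proof.
elim: M => [|M IH] fM; first by rewrite big_ord0; apply: spanned0.
rewrite big_ord_recr /= addrC; apply: spanned_lin; first exact: fM.
by apply: IH => i iM; apply/fM/ltnW.
Qed.

Lemma spanned_leq R (q : nat -> R) N M x : (N <= M)%N -> spanned q N x -> spanned q M x.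
Proof.
move=> NM [c ->]; apply: spanned_sum => i iN.
exact: spanned_mem (leq_trans iN NM).
Qed.

(** The chain condition in sequential form, as [krull] uses it: some term lies in the ideal of its
    predecessors. *)
Definition noetherian R := forall q : nat -> R, exists N, spanned q N (q N).

Lemma field_noetherian (F : fieldType) : noetherian F.
Proof.
move=> q; have [q0|q0] := eqVneq (q 0%N) 0; first by exists 0%N; rewrite q0; apply: spanned0.
by exists 1%N, (fun=> q 1%N / q 0%N); rewrite big_ord1 divfK.
Qed.

(** If no [p N] lies in the ideal of its predecessors, one can always choose in the ideal [I] of all
    [p] a polynomial [f n] of minimal size outside the ideal of the earlier choices. A relation
    between leading coefficients then produces a smaller one. *)
Lemma poly_noetherian R : noetherian R -> noetherian {poly R}.
Proof.
move=> nR p; apply: contrapT => nsp.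
pose I x := exists N, spanned p N x.
pose good (l : seq {poly R}) f := [/\ I f, ~ spanned (nth 0 l) (size l) f &
  forall g, I g -> ~ spanned (nth 0 l) (size l) g -> (size f <= size g)%N].
have I_lin z x y : I x -> I y -> I (z * x + y).
  move=> [N xN] [M yM]; exists (maxn N M); apply: spanned_lin.
    exact: spanned_leq (leq_maxl _ _) xN.
  exact: spanned_leq (leq_maxr _ _) yM.
have /choice[F FP] (l : seq {poly R}) : exists f,
    (forall x, x \in l -> I x) -> good l f.
  have [lI|nl] := pselect (forall x, x \in l -> I x); last by exists 0.
  have [M lM] : exists M, forall x, x \in l -> spanned p M x.
    elim: l lI => [|y l IH] lI; first by exists 0%N.
    have [M1 y1] := lI y (mem_head _ _).
    have [|M2 l2] := IH; first by move=> x xl; apply: lI; rewrite inE xl orbT.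
    exists (maxn M1 M2) => x; rewrite inE => /predU1P[->|xl].
      exact: spanned_leq (leq_maxl _ _) y1.
    exact: spanned_leq (leq_maxr _ _) (l2 x xl).
  pose sz n := `[< exists f, [/\ I f, ~ spanned (nth 0 l) (size l) f & size f = n] >].
  have sz0 : exists n, sz n.
    exists (size (p M)); apply/asboolP; exists (p M); split=> //.
      by exists M.+1; apply: spanned_mem.
    move=> [c pc]; apply: nsp; exists M; rewrite pc.
    by apply: spanned_sum => i il; apply/lM/mem_nth.
  case: (ex_minnP sz0) => n /asboolP[f [If nf <-]] nmin.
  by exists f => _; split=> // g Ig ng; apply: nmin; apply/asboolP; exists g.
pose L := fix L n := if n is n'.+1 then rcons (L n') (F (L n')) else [::].
pose f n := F (L n).
have LE n : L n = mkseq f n by elim: n => //= n IH; rewrite mkseqS -IH.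
have LI n x : x \in L n -> I x.
  elim: n x => [|n IH] x //=; rewrite mem_rcons inE => /predU1P[->|/IH //].
  by have [] := FP (L n) IH.
have fP n : [/\ I (f n), ~ spanned f n (f n) &
    forall g, I g -> ~ spanned f n g -> (size (f n) <= size g)%N].
  have spE x : spanned (nth 0 (L n)) (size (L n)) x <-> spanned f n x.
    rewrite LE size_mkseq; split=> -[c ->]; exists c; apply: eq_bigr => i _;
    by rewrite nth_mkseq.
  have [I1 n1 m1] := FP (L n) (LI n); split=> // [/spE //|g Ig ng].
  by apply: m1 => // /spE.
have [N [c lc]] := nR (fun n => lead_coef (f n)).
have [IN nN mN] := fP N.
have fN0 : f N != 0 by apply: contra_notN nN => /eqP ->; apply: spanned0.
have szf i : (i < N)%N -> (size (f i) <= size (f N))%N.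
  move=> iN; have [_ _ mi] := fP i; apply: mi => // /(spanned_leq (ltnW iN)).
  exact: nN.
(* The powers of [X] raise each [f i] to the degree of [f N], so [h] has the same leading term as
   [f N]. *)
pose h := \sum_(i < N) (c i *: 'X^(size (f N) - size (f i))) * f i.
have sph : spanned f N h by exists (fun i => c i *: 'X^(size (f N) - size (f i))).
have Ih : I h.
  rewrite /h; elim/big_ind: _ => [||i _].
  - by exists 0%N; apply: spanned0.
  - by move=> x y Ix Iy; rewrite -[x]mul1r; apply: I_lin.
  - rewrite -[_ * _]addr0; apply: I_lin; first by have [] := fP i.
    by exists 0%N; apply: spanned0.
have := mN (f N - h); rewrite leqNgt => contra.
apply: (negP (contra _ _)).
- by rewrite addrC -mulN1r; apply: I_lin.
- move=> spN; apply: nN; rewrite -(subrK h (f N)) -[f N - h]mul1r.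
  exact: spanned_lin.
have szh : (size h <= size (f N))%N.
  apply: (leq_trans (size_sum _ _ _)); apply/bigmax_leqP => i _.
  rewrite -scalerAl; apply: (leq_trans (size_scale_leq _ _)).
  rewrite mulrC; have [->|fi0] := eqVneq (f i) 0; first by rewrite mul0r size_poly0.
  by rewrite size_mulXn // subnK // szf.
rewrite -[X in (_ < X)%N](prednK (n := size (f N))) ?size_poly_gt0 // ltnS.
apply/leq_sizeP => j; rewrite leq_eqVlt => /predU1P[<-|lt_j].
  rewrite coefB -lead_coefE lc /h coef_sum -sumrB big1 // => i _.
  rewrite -scalerAl coefZ coefXnM ltnNge.
  have fi := szf i (ltn_ord i).
  have -> : ((size (f N)).-1 - (size (f N) - size (f i)) = (size (f i)).-1)%N.
    by move: fi (size_poly_gt0 (f N)); rewrite fN0; lia.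
  have [->|fi0] := eqVneq (f i) 0; first by rewrite lead_coef0 !coef0 mulr0 if_same mulr0 subrr.
  have -> : (size (f N) - size (f i) <= (size (f N)).-1)%N.
    by move: fi (size_poly_gt0 (f i)); rewrite fi0; lia.
  by rewrite -lead_coefE subrr.
have szj : (size (f N) <= j)%N by rewrite -(prednK (n := size (f N))) ?size_poly_gt0.
by rewrite coefB (leq_sizeP _ _ szh) // (leq_sizeP _ _ (leqnn (size (f N)))) // subrr.
Qed.

Fixpoint iter_poly (F : fieldType) n : comNzRingType :=
  if n is n'.+1 then {poly (iter_poly F n')} else F.

Lemma iter_poly_noetherian F n : noetherian (iter_poly F n).
Proof. by elim: n => [|n IH]; [apply: field_noetherian|apply: poly_noetherian]. Qed.

(** The third clause is an induction principle for the image, used to bound it from above. *)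
Lemma iter_poly_eval (F : fieldType) (S : comNzRingType) (phi : {rmorphism F -> S})
    n (b : nat -> S) : exists theta : {rmorphism iter_poly F n -> S},
  [/\ forall c, exists x, theta x = phi c,
      forall i, (i < n)%N -> exists x, theta x = b i
    & forall Q : S -> Prop, (forall c, Q (phi c)) -> (forall i, Q (b i)) ->
      (forall x y, Q x -> Q y -> Q (x + y)) -> (forall x y, Q x -> Q y -> Q (x * y)) ->
      forall x, Q (theta x)].
Proof.
elim: n => [|n [theta [tc tb tQ]]].
  by exists phi; split=> // c; exists c.
have cm : commr_rmorph theta (b n) by move=> x; apply: mulrC.
exists (horner_morph cm); split=> [c|i|Q Qc Qb QD QM x].
- by have [x xc] := tc c; exists x%:P; rewrite /= horner_morphC.
- rewrite ltnS leq_eqVlt => /predU1P[->|/tb[x xb]].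
    by exists 'X; rewrite /= horner_morphX.
  by exists x%:P; rewrite /= horner_morphC.
- have Qt y : Q (theta y) by apply: tQ.
  elim/poly_ind: x => [|p c IH]; first by rewrite rmorph0 -(rmorph0 theta).
  by rewrite rmorphD rmorphM /= horner_morphX horner_morphC; apply/QD/Qt/QM/Qb.
Qed.
End NoetherianRings.

(** * The ideal of the identity: Euler operator and Krull's theorem *)

Section AugmentationIdeal.
Variables (k : closedFieldType) (char0 : [pchar k] =i pred0) (G : algGroup k).
Variables (n : nat) (r : mrep G n.+1) (r_gen : generating r).
Local Notation regf := (regf G).
Implicit Types f g h : regf.

Let t a b : regf := rmat r a b - (a == b)%:R.

Let t1 a b : t a b 1%g = 0.
Proof.
rewrite regfB -rhoE rho1 mxE; case: (a == b); first exact: subrr.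
exact: subrr.
Qed.

(* Powers of the ideal of the identity, which is generated by the [t a b]. *)
Fixpoint mpow N f : Prop :=
  if N is N'.+1 then exists2 c : 'I_n.+1 -> 'I_n.+1 -> regf,
    forall a b, mpow N' (c a b) & f = \sum_a \sum_b c a b * t a b
  else True.

Let mpow0 N : mpow N 0.
Proof.
elim: N => //= N IH; exists (fun _ _ => 0) => //.
by rewrite big1 // => a _; rewrite big1 // => b _; rewrite mul0r.
Qed.

Let mpow_lin N g f h : mpow N f -> mpow N h -> mpow N (g * f + h).
Proof.
elim: N g f h => //= N IH g _ _ [c cN ->] [e eN ->].
exists (fun a b => g * c a b + e a b) => [a b|]; first exact: IH.
rewrite mulr_sumr -big_split; apply: eq_bigr => a _.
by rewrite mulr_sumr -big_split; apply: eq_bigr => b _ /=; ring.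
Qed.

Let mpowD N f h : mpow N f -> mpow N h -> mpow N (f + h).
Proof. by move=> fN hN; rewrite -[f]mul1r; apply: mpow_lin. Qed.

Let mpowM N g f : mpow N f -> mpow N (g * f).
Proof. by move=> fN; rewrite -[g * f]addr0; apply: mpow_lin. Qed.

Let mpowZ N c f : mpow N f -> mpow N (c *: f).
Proof. by move=> fN; rewrite -[f]mul1r scalerAl; apply: mpowM. Qed.

Let mpowB N f h : mpow N f -> mpow N h -> mpow N (f - h).
Proof. by move=> fN hN; rewrite addrC -mulN1r; apply: mpow_lin. Qed.

Let mpow_sum N I (s : seq I) (F : I -> regf) :
  (forall i, mpow N (F i)) -> mpow N (\sum_(i <- s) F i).
Proof. by move=> FN; elim/big_ind: _ => // *; apply: mpowD. Qed.

Let t_mpow N c a b : mpow N c -> mpow N.+1 (c * t a b).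
Proof.
move=> cN; exists (fun a' b' => if (a' == a) && (b' == b) then c else 0) => [a' b'|].
  by case: ifP.
rewrite (bigD1 a) //= (bigD1 b) //= !eqxx [X in _ = _ + X + _]big1 => [|b' /negbTE b'b].
  rewrite [X in _ + X]big1 ?addr0 // => a' /negbTE a'a.
  by rewrite big1 // => b' _; rewrite a'a mul0r.
by rewrite b'b mul0r.
Qed.

Let constM f h : (f * h) 1%g *: 1 = (f 1%g *: 1) * (h 1%g *: 1) :> regf.
Proof. by rewrite -scalerAl mul1r scalerA. Qed.

Let mpow1E f : f 1%g = 0 -> mpow 1 f.
Proof.
suff : mpow 1 (f - (f 1%g) *: 1) by move=> H f0; move: H; rewrite f0 scale0r subr0.
move: f; apply: r_gen => [c|f h fP hP|f h fP hP|a b].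
- have -> : c *: 1 - (c *: 1 : regf) 1%g *: 1 = 0 :> regf.
    by rewrite regfZ regf1 mulr1 subrr.
  exact: mpow0.
- have -> : f + h - (f + h) 1%g *: 1 = (f - f 1%g *: 1) + (h - h 1%g *: 1) :> regf.
    by rewrite regfD scalerDl opprD addrACA.
  exact: mpowD.
- have -> : f * h - (f * h) 1%g *: 1 =
      h * (f - f 1%g *: 1) + (f 1%g *: 1) * (h - h 1%g *: 1) :> regf.
    by rewrite constM; ring.
  exact/mpow_lin/mpowM.
- have -> : rmat r a b - rmat r a b 1%g *: 1 = 1 * t a b.
    rewrite mul1r -rhoE rho1 mxE scaler_nat; congr (_ - _).
  by apply: t_mpow.
Qed.

Let mpow_mul N f g : mpow N f -> mpow 1 g -> mpow N.+1 (f * g).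
Proof.
move=> fN [c _ ->]; rewrite mulr_sumr; apply: mpow_sum => a.
rewrite mulr_sumr; apply: mpow_sum => b.
by rewrite mulrA; apply: t_mpow; rewrite mulrC; apply: mpowM.
Qed.

Let lincomb (c : 'M[k]_n.+1) : regf := \sum_a \sum_b c a b *: t a b.

Let lincomb_lin z c e : lincomb (z *: c + e) = z *: lincomb c + lincomb e.
Proof.
rewrite /lincomb scaler_sumr -big_split; apply: eq_bigr => a _ /=.
rewrite scaler_sumr -big_split; apply: eq_bigr => b _ /=.
by rewrite !mxE scalerDl scalerA.
Qed.

Let lincomb0 : lincomb 0 = 0.
Proof.
by rewrite /lincomb big1 // => a _; rewrite big1 // => b _; rewrite mxE scale0r.
Qed.

Let lincombZ z c : lincomb (z *: c) = z *: lincomb c.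
Proof. by rewrite -[z *: c]addr0 lincomb_lin lincomb0 addr0. Qed.

Let lincombB c e : lincomb (c - e) = lincomb c - lincomb e.
Proof. by rewrite addrC -scaleN1r lincomb_lin scaleN1r addrC. Qed.

Let cotangent f : exists c, mpow 2 (f - f 1%g *: 1 - lincomb c).
Proof.
have [|c _ cE] := @mpow1E (f - f 1%g *: 1).
  by rewrite regfB regfZ regf1 mulr1 subrr.
exists (\matrix_(a, b) c a b 1%g); rewrite cE /lincomb -sumrB.
apply: mpow_sum => a; rewrite -sumrB; apply: mpow_sum => b.
have -> : c a b * t a b - (\matrix_(a, b) c a b 1%g) a b *: t a b
    = (c a b - c a b 1%g *: 1) * t a b.
  by rewrite mxE mulrBl -scalerAl mul1r.
by apply/t_mpow/mpow1E; rewrite regfB regfZ regf1 mulr1 subrr.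
Qed.

(* Point derivations dual to the generators [t a b] of the cotangent space. *)
Let dual_pders : exists d : 'I_n.+1 -> 'I_n.+1 -> regf -> k,
  (forall a b, pder (d a b)) /\
  forall f, mpow 2 (f - f 1%g *: 1 - \sum_a \sum_b d a b f *: t a b).
Proof.
have [||N NP] := @vspace_of_set _ _ (fun c : 'M[k]_n.+1 => mpow 2 (lincomb c)).
- rewrite /lincomb big1 // => a _; rewrite big1 // => b _.
  by rewrite mxE scale0r.
- by move=> z u v uN vN; rewrite lincomb_lin; apply/mpowD => //; apply: mpowZ.
(* The [t a b] may be dependent modulo the square of the ideal. Projecting along the space [N] of
   their relations makes the coordinates independent of the choice of [c], hence linear in [f]. *)
pose P : 'End('M[k]_n.+1) := \1%VF - projv N.
have PV v : P v = v - projv N v by rewrite add_lfunE opp_lfunE id_lfunE.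
have PN v : v \in N -> P v = 0 by move=> Nv; rewrite PV projv_id ?subrr.
have [c cP] := choice cotangent.
have PE f e : mpow 2 (f - f 1%g *: 1 - lincomb e) -> P (c f) = P e.
  move=> fe; apply/eqP; rewrite -subr_eq0 -linearB; apply/eqP/PN/NP.
  have -> : lincomb (c f - e) = (f - f 1%g *: 1 - lincomb e)
      - (f - f 1%g *: 1 - lincomb (c f)).
    by rewrite lincombB; ring.
  exact: mpowB.
exists (fun a b f => P (c f) a b); split=> [a b|f]; last first.
  rewrite -/(lincomb (P (c f))) PV lincombB opprB addrA addrAC.
  by apply: mpowD; [exact: cP|apply/NP/memv_proj].
split=> [z f h|f h].
  rewrite -[RHS]/((z * P (c f) a b + P (c h) a b)).
  rewrite (PE _ (z *: c f + c h)) ?linearP ?mxE //.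
  have -> : z *: f + h - (z *: f + h) 1%g *: 1 - lincomb (z *: c f + c h)
      = z *: (f - f 1%g *: 1 - lincomb (c f)) + (h - h 1%g *: 1 - lincomb (c h)).
    by rewrite lincomb_lin regfD regfZ !scalerBr scalerDl scalerA; ring.
  by apply: mpowD => //; apply: mpowZ.
rewrite (PE _ (f 1%g *: c h + h 1%g *: c f)).
  by rewrite linearD !linearZ !mxE; ring.
have -> : f * h - (f * h) 1%g *: 1 - lincomb (f 1%g *: c h + h 1%g *: c f)
   = (f - f 1%g *: 1) * (h - h 1%g *: 1)
     + (f 1%g *: (h - h 1%g *: 1 - lincomb (c h)) + h 1%g *: (f - f 1%g *: 1 - lincomb (c f))).
  rewrite constM lincomb_lin lincombZ.
  rewrite -(mulr_algl (f 1%g) (lincomb _)) -(mulr_algl (h 1%g) (lincomb _)).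
  by rewrite -(mulr_algl (f 1%g) (h - _ - _)) -(mulr_algl (h 1%g) (f - _ - _)); ring.
apply: mpowD; last by apply: mpowD; apply: mpowZ.
have m1 g : mpow 1 (g - g 1%g *: 1) by apply: mpow1E; rewrite regfB regfZ regf1 mulr1 subrr.
exact: mpow_mul.
Qed.
Let mpow_mul2 N f g : mpow N f -> mpow 2 g -> mpow N.+2 (f * g).
Proof.
move=> fN [c c1 ->]; rewrite mulr_sumr; apply: mpow_sum => a.
rewrite mulr_sumr; apply: mpow_sum => b.
by rewrite mulrA; apply/t_mpow/mpow_mul.
Qed.

(* The Euler operator [\sum_a \sum_b t a b * D_(a,b)] acts on the N-th graded piece
   of the augmentation filtration as multiplication by N. *)
Lemma mpow_of_constant h : h 1%g = 0 ->
  (forall d (dP : pder d), linv dP h = 0) -> forall N, mpow N h.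
Proof.
move=> h1 hD; have [d [dP dual]] := dual_pders.
pose Eu f := \sum_a \sum_b t a b * linv (dP a b) f.
have EuD f g : Eu (f + g) = Eu f + Eu g.
  rewrite -big_split; apply: eq_bigr => a _; rewrite -big_split; apply: eq_bigr => b _.
  by rewrite /= raddfD mulrDr.
have EuM f g : Eu (f * g) = Eu f * g + f * Eu g.
  rewrite mulr_suml mulr_sumr -big_split; apply: eq_bigr => a _ /=.
  rewrite mulr_suml mulr_sumr -big_split; apply: eq_bigr => b _ /=.
  by rewrite linvM; ring.
have Eu0 : Eu 0 = 0.
  by rewrite /Eu big1 // => a _; rewrite big1 // => b _; rewrite raddf0 mulr0.
have Eu_sum I (s : seq I) (F : I -> regf) : Eu (\sum_(i <- s) F i) = \sum_(i <- s) Eu (F i).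
  by apply: (big_morph _ EuD Eu0).
have Eu1 f : f 1%g = 0 -> mpow 2 (Eu f - f).
  move=> f1; have := dual f; rewrite f1 scale0r subr0 => fd.
  have -> : Eu f - f = (Eu f - \sum_a \sum_b d a b f *: t a b)
      - (f - \sum_a \sum_b d a b f *: t a b) by ring.
  apply: mpowB => //; rewrite -sumrB; apply: mpow_sum => a.
  rewrite -sumrB; apply: mpow_sum => b.
  have -> : t a b * linv (dP a b) f - d a b f *: t a b
      = (linv (dP a b) f - d a b f *: 1) * t a b.
    by rewrite [RHS]mulrBl -scalerAl mul1r mulrC.
  by apply/t_mpow/mpow1E; rewrite regfB linv1 regfZ mulr1 subrr.
have EuN N f : mpow N f -> mpow N.+1 (Eu f - N%:R * f).
  elim: N f => [|N IH] f.
    move=> _; apply: mpow1E; rewrite mul0r subr0 regf_sum big1 // => a _.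
    by rewrite regf_sum big1 // => b _; rewrite regfM t1 mul0r.
  move=> [c cN ->]; rewrite Eu_sum mulr_sumr -sumrB; apply: mpow_sum => a.
  rewrite Eu_sum mulr_sumr -sumrB; apply: mpow_sum => b.
  have -> : Eu (c a b * t a b) - N.+1%:R * (c a b * t a b)
      = (Eu (c a b) - N%:R * c a b) * t a b + c a b * (Eu (t a b) - t a b).
    by rewrite EuM -natr1; ring.
  apply: mpowD; first by apply: mpow_mul (IH _ (cN a b)) (mpow1E (t1 a b)).
  exact: mpow_mul2 (cN a b) (Eu1 _ (t1 a b)).
(* As [Eu h = 0], a multiple [N.+1 * h] lies in the next power and can be divided by [N.+1]. The
   passage from 0 to 1 has no such divisor and uses [h 1 = 0]. *)
elim=> // N IH; case: N IH => [_|N IH]; first exact: mpow1E.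
have := EuN _ _ IH.
have -> : Eu h = 0 by rewrite /Eu big1 // => a _; rewrite big1 // => b _; rewrite hD mulr0.
move=> /(mpowZ (- (N.+1%:R)^-1)); congr mpow.
by rewrite sub0r scaleNr scalerN opprK mulr_natl -scaler_nat scalerA mulVf ?scale1r ?natk_neq0.
Qed.

(* Krull's intersection theorem at the identity, from the Rees algebra. *)
Lemma krull h : (forall N, mpow N h) -> exists2 z : regf, z 1%g = 0 & h = z * h.
Proof.
move=> hN; pose phi : {rmorphism k -> {poly regf}} := polyC \o in_alg regf.
pose ab := enum {: 'I_n.+1 * 'I_n.+1}.
(* Generators of the Rees algebra inside [{poly regf}]: the entries in degree 0 and the [t a b] in
   degree 1. *)
pose s : seq {poly regf} := [seq (rmat r p.1 p.2)%:P | p <- ab]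
  ++ [seq (t p.1 p.2)%:P * 'X | p <- ab].
have [theta [tc tb tQ]] := iter_poly_eval phi (size s) (nth 0 s).
pose im x := exists y, theta y = x.
have imD x y : im x -> im y -> im (x + y).
  by move=> [x' <-] [y' <-]; exists (x' + y'); rewrite rmorphD.
have imM x y : im x -> im y -> im (x * y).
  by move=> [x' <-] [y' <-]; exists (x' * y'); rewrite rmorphM.
have ims x : x \in s -> im x.
  by move=> xs; rewrite -(nth_index 0 xs); apply: tb; rewrite index_mem.
have imr f : im f%:P.
  move: f; apply: r_gen => [c|f g If Ig|f g If Ig|a b].
  - exact: tc.
  - by rewrite polyCD; apply: imD.
  - by rewrite polyCM; apply: imM.
  - by apply: ims; rewrite mem_cat; apply/orP; left; apply/mapP; exists (a, b); rewrite ?mem_enum.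
have imt a b : im ((t a b)%:P * 'X).
  by apply: ims; rewrite mem_cat; apply/orP; right; apply/mapP; exists (a, b); rewrite ?mem_enum.
have im0 : im 0 by exists 0; rewrite rmorph0.
have im_mpow N f : mpow N f -> im (f%:P * 'X^N).
  elim: N f => [|N IH] f; first by rewrite expr0 mulr1 => _; apply: imr.
  move=> [c cN ->]; rewrite rmorph_sum mulr_suml /=.
  elim/big_ind: _ => // a _; rewrite rmorph_sum mulr_suml /=.
  elim/big_ind: _ => // b _; rewrite polyCM exprSr.
  have -> : (c a b)%:P * (t a b)%:P * ('X^N * 'X) = ((c a b)%:P * 'X^N) * ((t a b)%:P * 'X).
    by ring.
  exact: imM (IH _ (cN a b)) (imt a b).
pose Q (x : {poly regf}) := forall j, x`_j.+1 1%g = 0.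
have tQ1 x : Q (theta x).
  apply: tQ => [c j|i j|x1 y1 Qx Qy j|x1 y1 Qx Qy j].
  - by rewrite /= coefC.
  - have [si|si] := ltnP i (size s); last first.
      rewrite /Q (nth_default _ si); exact: (congr1 (ev 1%g) (coef0 _ j.+1)).
    have := mem_nth 0 si; rewrite mem_cat => /orP[] /mapP[p _ ->]; first by rewrite coefC.
    by rewrite coefCM coefX; case: j => [|j]; rewrite ?mulr1 ?t1 // mulr0.
  - by rewrite coefD regfD Qx Qy addr0.
  - rewrite coefM regf_sum big1 // => i _; rewrite regfM.
    case: (nat_of_ord i) => [|l]; last by rewrite Qx mul0r.
    by rewrite subn0 Qy mulr0.
have /choice[q qE] N := im_mpow N h (hN N).
(* This writes [h X^N] as a combination of the [h X^i] with [i < N]. In degree [N], the coefficients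
   involved have degree [N - i > 0] in the Rees algebra, so they vanish at 1. *)
have [N [c cE]] := iter_poly_noetherian q.
pose z : regf := \sum_(i < N) (theta (c i))`_(N - i)%N.
exists z.
  rewrite regf_sum big1 // => i _.
  have -> : (N - i)%N = (N - i).-1.+1 by have := ltn_ord i; lia.
  exact: tQ1.
have := congr1 (fun x => (theta x)`_N) cE; rewrite qE coefCM coefXn eqxx mulr1 => {1}->.
rewrite rmorph_sum coef_sum mulr_suml; apply: eq_bigr => i _.
by rewrite rmorphM qE mulrA coefMXn ltnNge ltnW //= coefMC.
Qed.
End AugmentationIdeal.

(** * Representations with zero derivative: finite image and averaging *)

Section FiniteImage.
Variables (k : closedFieldType) (char0 : [pchar k] =i pred0) (G : algGroup k).
Variables (m : nat) (E : mrep G m.+1).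
Hypothesis dE : forall d, pder d -> dmx d E = 0.

(** The product [s] of the [1 - z p] kills every entry of E minus the identity and is 1 at the
    identity, so E is trivial where [s] is nonzero. Finitely many translates of that set cover G. *)
Lemma finite_image : exists s : seq 'M[k]_m.+1, forall g, rho E g \in s.
Proof.
have [n [r r_gen]] := exists_faithful G.
pose h i j : regf G := rmat E i j - (i == j)%:R *: 1.
have h1 i j : h i j 1%g = 0.
  by rewrite /h regfB regfZ mulr1 -rhoE rho1 mxE subrr.
have /choice[z zP] (p : 'I_m.+1 * 'I_m.+1) :
    exists z : regf G, z 1%g = 0 /\ h p.1 p.2 = z * h p.1 p.2.
  have [|z z1 zh] := @krull _ _ _ r r_gen (h p.1 p.2); last by exists z.
  apply: mpow_of_constant => // d dP.
  by rewrite /h raddfB /= linv_const rmat_mcoef linv_mcoef dE // mul0mx mcoef0r subr0.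
pose s : regf G := \prod_p (1 - z p).
have s1 : s 1%g = 1.
  rewrite -[LHS]/(ev 1%g s) rmorph_prod big1 // => p _.
  by rewrite rmorphB rmorph1 /= /ev (zP p).1 subr0.
have s_rho x : s x != 0 -> rho E x = 1%:M.
  move=> sx; apply/matrixP => i j; rewrite rhoE [RHS]mxE; apply/eqP.
  rewrite -subr_eq0; have -> : rmat E i j x - (i == j)%:R = h i j x.
    by rewrite /h regfB regfZ mulr1.
  have : s * h i j = 0.
    have zh : h i j = z (i, j) * h i j := (zP (i, j)).2.
    by rewrite /s (bigD1 (i, j)) //= mulrAC mulrBl mul1r -zh subrr mul0r.
  move=> /(congr1 (ev x)); rewrite rmorphM rmorph0 => /eqP.
  by rewrite mulf_eq0 (negbTE sx).
pose F (i : 'I_2) : regf G := if i == ord0 then 1 else s.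
have [//|N [r' [u [g [ug FE]]]]] := @matrix_coefs _ _ _ F ord0.
exists [seq rho E (g i)^-1%g | i <- enum 'I_N.+1] => x.
(* If [s] vanished at all the [g i * x], then [rho r' x *m v] would be 0, hence also [v], and [s]
   would vanish at 1. *)
have [i si] : exists i, s (g i * x)%g != 0.
  apply: contrapT => ns.
  pose v := \col_i F ord_max (g i).
  have sE y : s y = (u *m rho r' y *m v) 0 0 by rewrite -FE.
  have v0 : rho r' x *m v = 0.
    apply/colP => i; rewrite [RHS]mxE; apply/eqP; apply: contraT => nz.
    case: ns; exists i; rewrite sE rhoM mulmxA ug -mulmxA -rowE mxE; exact: nz.
  have : s 1%g = 0.
    by rewrite sE -(mulVg x) rhoM -!mulmxA v0 !mulmx0 mxE.
  by move=> /eqP; rewrite s1 oner_eq0.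
apply/mapP; exists i; rewrite ?mem_enum //.
by rewrite -[LHS](mul1mx) -(rhoVl E (g i)) -mulmxA -(rhoM E (g i)) (s_rho _ si) mulmx1.
Qed.

Lemma average_fixed (c : 'cV[k]_m.+1) : c != 0 -> (forall g, rho E g *m c = c) ->
  exists v : 'rV_m.+1, (forall g, v *m rho E g = v) /\ v *m c = 1%:M.
Proof.
move=> c0 Ec; have [s0 s0P] := finite_image.
(* The list [s0] may exceed the image and repeat matrices; [s] lists the image exactly once, so
   right multiplication permutes it. *)
pose s := [seq M <- undup s0 | `[< exists g, rho E g = M >]].
have sP M : reflect (exists g, rho E g = M) (M \in s).
  rewrite mem_filter mem_undup; apply: (iffP andP) => [[/asboolP] //|[g gM]].
  by split; [apply/asboolP; exists g|rewrite -gM].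
have s_gt0 : ((size s)%:R : k) != 0.
  rewrite natk_eq0 // size_eq0; apply/eqP => s_nil.
  have /sP sr : exists g, rho E g = rho E 1%g by exists 1%g.
  by rewrite s_nil in sr.
pose A := (size s)%:R^-1 *: \sum_(M <- s) M.
have Ac : A *m c = c.
  rewrite -scalemxAl mulmx_suml big_seq (eq_bigr (fun=> c)) => [|_ /sP[g <-] //].
  rewrite -big_seq big_const_seq count_predT iter_addr_0 -scaler_nat scalerA.
  by rewrite mulVf // scale1r.
have AE g : A *m rho E g = A.
  rewrite -scalemxAl mulmx_suml; congr (_ *: _).
  rewrite -(big_map (mulmx^~ (rho E g)) xpredT id); apply: perm_big.
  have inj : injective (fun M : 'M[k]_m.+1 => M *m rho E g).
    by apply: (can_inj (g := mulmx^~ (rho E g^-1%g))) => M; rewrite -mulmxA rhoVr mulmx1.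
  apply: uniq_perm; rewrite ?map_inj_uniq ?filter_uniq ?undup_uniq // => M.
  apply/mapP/sP => [[_ /sP[x <-] ->]|[x <-]]; first by exists (x * g)%g; rewrite rhoM.
  exists (rho E (x * g^-1)%g); first by apply/sP; exists (x * g^-1)%g.
  by rewrite -rhoM mulgVK.
have [i ci] : exists i, c i 0 != 0.
  apply: contrapT => nc; case/negP: c0; apply/eqP/colP => i; rewrite mxE.
  by apply/eqP; apply: contraT => ci; case: nc; exists i.
exists ((c i 0)^-1 *: delta_mx 0 i *m A); split=> [g|]; first by rewrite -mulmxA AE.
rewrite -mulmxA Ac -scalemxAl -rowE; apply/matrixP => a b.
by rewrite !ord1 !mxE mulVf.
Qed.
End FiniteImage.

(** * Linear reductivity and a finite substitute for invariant integration *)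

Section Reynolds.
Variables (k : closedFieldType) (char0 : [pchar k] =i pred0).
Variables (G : algGroup k) (Gred : reductive G).
Local Notation regf := (regf G).

Lemma dmx_fixed m (E : mrep G m.+1) (c : 'cV[k]_m.+1) d : pder d ->
  (forall g, rho E g *m c = c) -> dmx d E *m c = 0.
Proof.
move=> dP Ec; apply/colP => i; rewrite [RHS]mxE.
have := pder_mcoef dP E (delta_mx 0 i) c; rewrite -mulmxA -rowE mxE => <-.
rewrite -[RHS](pder_const dP (c i 0)); congr d; apply: regf_ext => x.
by rewrite mcoefE -mulmxA Ec -rowE mxE regfZ mulr1.
Qed.

(* Replaces E by its quotient by the kernel of B. *)
Lemma quotient_rep m (E : mrep G m.+1) (B : 'M[k]_m.+1) :
  B != 0 -> (forall g, B *m rho E g = rho E g *m B) ->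
  exists r (Q : 'M[k]_(r.+1, m.+1)) (E' : mrep G r.+1),
    [/\ r.+1 = \rank B, exists P, P *m Q = B & forall g, rho E' g *m Q = Q *m rho E g].
Proof.
move=> B0 BE.
have [r [Q [rB Qf QB]]] : exists r (Q : 'M[k]_(r, m.+1)),
    [/\ r = \rank B, row_free Q & (Q :=: B)%MS].
  by exists (\rank B), (row_base B); split=> //; [apply: row_base_free|apply: eq_row_base].
case: r Q rB Qf QB => [|r] Q rB Qf QB.
  by move: B0; rewrite -mxrank_eq0 -rB eqxx.
have stab g : (Q *m rho E g <= Q)%MS.
  by rewrite (eqmxMr _ QB) QB BE submxMl.
pose M g := Q *m rho E g *m pinvmx Q.
have MQ g : M g *m Q = Q *m rho E g by apply: mulmxKpV.
have [|||E' E'E] := @mkrep k G r.+1 M.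
- move=> i j; have -> : (fun x => M x i j)
      = mcoef E (delta_mx 0 i *m Q) (pinvmx Q *m delta_mx j 0).
    by apply/funext => x; rewrite mcoefE mx_entry /M !mulmxA.
  exact: regfP.
- by rewrite /M rho1 mulmx1 mulmxVp.
- move=> x y; transitivity (M x *m Q *m rho E y *m pinvmx Q).
    by rewrite MQ /M rhoM !mulmxA.
  by rewrite /M !mulmxA.
exists r, Q, E'; split=> // [|g]; last by rewrite E'E.
have /submxP[P PB] : (B <= Q)%MS by rewrite QB.
by exists P.
Qed.

Lemma invariant_row m (E : mrep G m.+1) (c : 'cV[k]_m.+1) :
  c != 0 -> (forall g, rho E g *m c = c) ->
  exists v : 'rV_m.+1, (forall g, v *m rho E g = v) /\ v *m c = 1%:M.
Proof.
have [N mN] := ubnP m; elim: N m mN E c => // N IH m mN E c c0 Ec.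
have [dE|nd] := pselect (forall d, pder d -> dmx d E = 0).
  exact: average_fixed.
have [|C [trC Cw CE]] := equivariant_casimir char0 Gred (E := E).
  apply: contrapT => nd'; apply: nd => d dP; apply: contrapT => dE.
  by apply: nd'; exists d.
have Cc : C *m c = 0 by apply: Cw => d dP; apply: dmx_fixed.
have [l [l0 /eigenvalueP[u uC u0]]] : exists l, l != 0 /\ eigenvalue C l.
  have [s [_ _ sE trs]] := trace_horner C.
  apply: contrapT => nl; move: trC; have := trs 'X; rewrite horner_mx_X => ->.
  rewrite big_seq big1 ?eqxx // => a sa; rewrite hornerX; apply: contrapT => /eqP a0.
  by apply: nl; exists a; split=> //; apply: sE.
(* [C] kills [c], so [B] scales [c] by [- l] and [c] stays nonzero modulo the kernel of [B]; the
   eigenvector [u] shows that [B] is singular. *)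
pose B := C - l%:M.
have Bc : B *m c = - l *: c by rewrite mulmxBl Cc sub0r mul_scalar_mx scaleNr.
have Bc0 : B *m c != 0 by rewrite Bc scaler_eq0 oppr_eq0 negb_or l0.
have [||r [Q [E' [rB [P PB] E'Q]]]] := @quotient_rep m E B.
- by apply: contraNneq Bc0 => ->; rewrite mul0mx.
- by move=> g; rewrite mulmxBl mulmxBr CE scalar_mxC.
have uB : u *m B = 0 by rewrite mulmxBr uC mul_mx_scalar subrr.
have rm : (r < N)%N.
  suff : (\rank B < m.+1)%N by rewrite -rB; move: mN; lia.
  rewrite ltn_neqAle rank_leq_row andbT; apply: contraNneq u0 => /eqP Bf.
  have /row_freeP[B' BB'] : row_free B by [].
  by rewrite -[u]mulmx1 -BB' mulmxA uB mul0mx.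
have [||v [vE' vc]] := IH r rm E' (Q *m c).
- by apply: contraNneq Bc0 => Qc; rewrite -PB -mulmxA Qc mulmx0.
- by move=> g; rewrite mulmxA E'Q -mulmxA Ec.
exists (v *m Q); split=> [g|]; last by rewrite -mulmxA.
by rewrite -mulmxA -E'Q mulmxA vE'.
Qed.

(** The values of the constant 1 at the [g i] form an invariant column of ones; the entries of an
    invariant row pairing to 1 with it are the weights. *)
Lemma reynolds (s : seq regf) : exists N (c : 'I_N -> k) (g : 'I_N -> G),
  \sum_i c i = 1 /\ forall f, f \in s -> forall h,
    \sum_i c i * f (g i * h)%g = \sum_i c i * f (g i).
Proof.
pose F (i : 'I_(size s).+1) : regf := if unlift ord0 i is Some j then tnth (in_tuple s) j else 1.
have F0 : F ord0 = 1 by rewrite /F unlift_none.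
have [n [r [u [g [ug FE]]]]] := matrix_coefs F0.
pose w a : 'cV[k]_n.+1 := \col_i F a (g i).
have row_rho i h a : ((delta_mx 0 i : 'rV[k]_n.+1) *m rho r h *m w a) 0 0 = F a (g i * h)%g.
  by rewrite -(ug i) -(mulmxA u) -rhoM [RHS]FE.
have w0 i : w ord0 i 0 = 1 by rewrite mxE F0.
have [||v [vr vw]] := @invariant_row n r (w ord0).
- by apply/eqP => /colP/(_ ord0) /eqP; rewrite w0 mxE oner_eq0.
- move=> h; apply/colP => i; rewrite w0 -[RHS](regf1 (G := G) (g i * h)%g) -F0 -row_rho.
  by rewrite -mulmxA -rowE [RHS]mxE.
exists n.+1, (v 0), g; split.
  have /matrixP/(_ 0 0) := vw; rewrite mxE [X in _ = X]mxE eqxx mulr1n => <-.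
  by apply: eq_bigr => i _; rewrite w0 mulr1.
move=> f fs h; have [j fE] : exists j, f = F (lift ord0 j).
  have is_ : (index f s < size s)%N by rewrite index_mem.
  by exists (Ordinal is_); rewrite /F liftK (tnth_nth 0) /= nth_index.
transitivity ((v *m rho r h *m w (lift ord0 j)) 0 0).
  rewrite {2}[v]row_sum_delta !mulmx_suml summxE; apply: eq_bigr => i _.
  by rewrite -!scalemxAl mxE row_rho fE.
by rewrite vr mxE; apply: eq_bigr => i _; rewrite mxE fE.
Qed.
End Reynolds.

(** * Linear lifts out of finite-dimensional modules *)

Lemma linear_sum_scale (k : pzRingType) (V W : lmodType k) (f : V -> W) (fl : linear f)
    I (r : seq I) (b : I -> k) (y : I -> V) :
  f (\sum_(i <- r) b i *: y i) = \sum_(i <- r) b i *: f (y i).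
Proof.
have f0 : f 0 = 0.
  have := fl 1 0 0; rewrite !scale1r addr0 => e0.
  by apply: (addrI (f 0)); rewrite -e0 addr0.
elim: r => [|i r IH]; first by rewrite !big_nil.
by rewrite !big_cons fl IH.
Qed.

Section LinearMaps.
Variables (k : fieldType) (V : lmodType k).

(** A spanning family of minimal size is free, so arbitrarily chosen coordinates are automatically
    linear. *)
Lemma finite_dimensional_basis : (exists n (e : 'I_n -> V),
    forall v, exists c : 'I_n -> k, v = \sum_i c i *: e i) ->
  exists n (e : 'I_n -> V) (c : V -> 'I_n -> k),
    (forall v, v = \sum_i c v i *: e i) /\
    forall a u v i, c (a *: u + v) i = a * c u i + c v i.
Proof.
move=> fV.
pose good n := `[< exists e : 'I_n -> V,
  forall v, exists c : 'I_n -> k, v = \sum_i c i *: e i >].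
have g0 : exists n, good n by have [n nV] := fV; exists n; apply/asboolP.
case: (ex_minnP g0) => n /asboolP[e eV] nmin.
have free (c : 'I_n -> k) : \sum_i c i *: e i = 0 -> forall i, c i = 0.
  move=> c0 i; apply/eqP; apply: contraT => ci.
  case: n e eV nmin c c0 i ci => [|n] e eV nmin c c0 i ci; first by case: i ci.
  suff /nmin : good n by rewrite ltnn.
  apply/asboolP; exists (fun j => e (lift i j)) => v; have [b ->] := eV v.
  exists (fun j => b (lift i j) - b i * (c i)^-1 * c (lift i j)).
  have ei : e i = - \sum_(j < n) ((c i)^-1 * c (lift i j)) *: e (lift i j).
    move: c0; rewrite (bigD1_ord i) //= => /eqP; rewrite addr_eq0 => /eqP c0.
    apply: (scalerI ci); rewrite c0 scalerN scaler_sumr; congr (- _).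
    by apply: eq_bigr => j _; rewrite scalerA mulVKf.
  rewrite (bigD1_ord i) //= ei scalerN scaler_sumr -sumrN -big_split /=.
  by apply: eq_bigr => j _; rewrite scalerBl addrC scalerA mulrA.
have /choice[c cP] := eV.
exists n, e, c; split=> // a u v i; apply/eqP; rewrite -subr_eq0; apply/eqP.
apply: (free (fun i => c (a *: u + v) i - (a * c u i + c v i))).
transitivity (\sum_i c (a *: u + v) i *: e i
    - (a *: (\sum_i c u i *: e i) + \sum_i c v i *: e i)); last by rewrite -!cP subrr.
rewrite scaler_sumr -big_split -sumrB /=.
by apply: eq_bigr => j _; rewrite scalerBl scalerDl scalerA.
Qed.

Lemma linear_lift (W X : lmodType k) (d : W -> X) (z : V -> X) :
  (exists n (e : 'I_n -> V), forall v, exists c : 'I_n -> k, v = \sum_i c i *: e i) ->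
  linear d -> linear z -> (forall v, exists w, d w = z v) ->
  exists2 h : V -> W, linear h & forall v, d (h v) = z v.
Proof.
move=> fV dl zl dz; have [n [e [c [cP cl]]]] := finite_dimensional_basis fV.
have /choice[w wP] i := dz (e i).
exists (fun v => \sum_i c v i *: w i) => [a u v|v].
  rewrite scaler_sumr -big_split; apply: eq_bigr => i _.
  by rewrite cl scalerDl scalerA.
rewrite (linear_sum_scale dl) [in RHS](cP v) (linear_sum_scale zl).
by apply: eq_bigr => i _; rewrite wP.
Qed.
End LinearMaps.

(** * Equivariant lifts by averaging *)

Section Lifting.
Variables (k : closedFieldType) (char0 : [pchar k] =i pred0).
Variables (G : algGroup k) (Gred : reductive G).
Local Notation regf := (regf G).

(** A regular map into a finite-dimensional subspace of [V]; the list carries that subspace, as [V]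
    itself may be infinite-dimensional. *)
Definition regular_orbit (V : lmodType k) (Psi : G -> V) :=
  exists s : seq (regf * V), forall x, Psi x = \sum_(p <- s) p.1 x *: p.2.

Lemma regular_orbit_sum (V : lmodType k) n (a : 'I_n -> regf) (Psi : 'I_n -> G -> V) :
  (forall i, regular_orbit (Psi i)) ->
  regular_orbit (fun x => \sum_i a i x *: Psi i x).
Proof.
move=> /choice[s sP].
exists (flatten [seq [seq (a i * p.1, p.2) | p <- s i] | i <- enum 'I_n]) => x.
rewrite big_flatten big_map big_enum; apply: eq_bigr => i _.
by rewrite big_map sP scaler_sumr; apply: eq_bigr => p _; rewrite scalerA.
Qed.

Lemma act_regular (V : ratModule G) (v : V) : regular_orbit (fun x => act x v).
Proof.
have [n [a [w [Ra aw]]]] := act_rational v.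
exists [seq (mkregf (Ra i), w i) | i <- enum 'I_n] => x.
by rewrite big_map big_enum aw.
Qed.

Lemma actV_regular (V : ratModule G) (v : V) : regular_orbit (fun x => act x^-1%g v).
Proof.
have [s sP] := act_regular v.
exists [seq (invf p.1, p.2) | p <- s] => x.
by rewrite big_map sP.
Qed.

(* Averages [x^-1 h (x m)] over the points given by [reynolds], for a linear lift h. *)
Lemma equivariant_lift (M V W : ratModule G) (d : HomG V W) (z : HomG M W) :
  finite_dimensional M -> (forall m, exists v, d v = z m) ->
  exists y : HomG M V, compG d y = z.
Proof.
move=> Mfin dz; have [[dl dG] [zl zG]] := (HomGP d, HomGP z).
have [h hl hP] := linear_lift Mfin dl zl dz.
have [n [e eM]] := Mfin.
pose Psi m (x : G) : V := act x^-1%g (h (act x m)).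
have Psi_lin x : linear (Psi^~ x).
  by move=> a u v; rewrite /Psi act_linear hl act_linear.
have /choice[s sP] i : regular_orbit (Psi (e i)).
  have [l [a [w [Ra aw]]]] := act_rational (e i).
  have [t tP] := regular_orbit_sum (fun j => mkregf (Ra j)) (fun j => actV_regular (h (w j))).
  exists t => x; rewrite -tP /Psi aw (linear_sum_scale hl).
  by rewrite (linear_sum_scale (act_linear x^-1%g)).
have [N [c [g [c1 cg]]]] := reynolds char0 Gred (flatten [seq [seq p.1 | p <- s i] | i <- enum 'I_n]).
have avg m x : \sum_j c j *: Psi m (g j * x)%g = \sum_j c j *: Psi m (g j).
  have [b ->] := eM m.
  have PsiE x' : \sum_j c j *: Psi (\sum_i b i *: e i) (g j * x')%g
      = \sum_i b i *: \sum_(p <- s i) (\sum_j c j * p.1 (g j * x')%g) *: p.2.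
    under eq_bigr do rewrite (linear_sum_scale (Psi_lin _)) scaler_sumr.
    rewrite exchange_big; apply: eq_bigr => i _ /=; rewrite scaler_sumr.
    under [RHS]eq_bigr do rewrite scaler_suml scaler_sumr.
    rewrite [RHS]exchange_big; apply: eq_bigr => j _ /=.
    rewrite sP !scaler_sumr; apply: eq_bigr => p _.
    by rewrite !scalerA mulrA [c j * _]mulrC.
  have := PsiE 1%g; under eq_bigr do rewrite mulg1; move=> ->; rewrite PsiE.
  apply: eq_bigr => i _; congr (_ *: _); rewrite big_seq [RHS]big_seq.
  apply: eq_bigr => p ps; congr (_ *: _).
  have pS : p.1 \in flatten [seq [seq p.1 | p <- s i] | i <- enum 'I_n].
    by apply/flatten_mapP; exists i; rewrite ?mem_enum //; apply: map_f.
  by rewrite cg //; under [RHS]eq_bigr do rewrite mulg1.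
pose y m := \sum_j c j *: Psi m (g j).
have yP : y \in is_ghom M V.
  rewrite unfold_in; apply/asboolP; split=> [a u v|x m].
    rewrite /y scaler_sumr -big_split; apply: eq_bigr => j _ /=.
    by rewrite Psi_lin scalerDr !scalerA mulrC.
  (* [Psi (act x m)] at [g j] is [x] applied to [Psi m] at [g j * x], so invariance of the mean
     gives equivariance. *)
  rewrite -[y m](avg m x) (linear_sum_scale (act_linear x)).
  apply: eq_bigr => j _; congr (_ *: _).
  by rewrite /Psi -!actM invgM mulVKg.
exists (MkHomG yP); apply: val_inj; apply/funext => m /=.
rewrite /y (linear_sum_scale dl) (eq_bigr (fun j => c j *: z m)).
  by rewrite -scaler_suml c1 scale1r.
by move=> j _; rewrite /Psi dG hP zG -actM mulVg act1.
Qed.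
End Lifting.

(** * Vanishing of Ext in positive degrees *)

Theorem mainTheorem11 (k : closedFieldType) (char0 : [pchar k]%R =i pred0)
  (G : algGroup k) (Gred : reductive G)
  (H : set G) (Hclosed : closed_subgroup H)
  (M N : ratModule G)
  (Mfin : finite_dimensional M) (Nfin : finite_dimensional N)
  (I : GHresolution H N) (i : nat) (i_gt0 : (0 < i)%N) :
  forall x : Ext M I i, x = 0%R.
Proof.
case: i i_gt0 => // j _; elim/quotW => z.
have zK m : Ker (res_diff I j.+1) (cocycle_val z m).
  have /eqP dz : res_diff I j.+1 \o val z == 0 :> (M -> I j.+2).
    have := valP z; rewrite unfold_in => /eqP/(congr1 (fun f : HomG M _ => f : M -> _)).
    by move=> /= ->.
  exact: (congr1 (fun f => f m) dz).
(* By exactness the cocycle takes its values in the image of the previous differential, which is all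
   that the lift requires. *)
have [y yz] : exists y : HomG M (I j), compG (res_diff I j) y = cocycle_val z.
  apply: (equivariant_lift char0 Gred) => // m.
  have := zK m; have [<- _] := res_exactS I j.
  by move=> [v _ vz]; exists v.
have zB : z \in @is_coboundary _ (fun j => @compG k G M (I j) (I j.+1) (res_diff I j)) j.+1.
  by rewrite unfold_in; apply/asboolP; exists y.
rewrite -[z]subr0 in zB; rewrite Quotient.idealrBE in zB.
rewrite (eqP zB).
by rewrite piE.
Qed.
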